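(* Let $M$ be a commutative monoid and $\mathcal{A}\in\mathcal{H}(M)$ a system of abelian groups over $M$. The Baer sum makes $\mathsf{Coext}(M,\mathcal{A})$ into a symmetric categorical group in the following way: - The unit object is the semidirect product $M\ltimes\mathcal{A}$. - The inverse of a coextension $\mathcal{E}=(0\to\mathcal{A}\to N\xrightarrow{\pi}M\to0)$ is $\mathcal{E}^{-1}:=\nu_*(\mathcal{E})$, where $\nu:\mathcal{A}\to\mathcal{A}$ is the negation $x\mapsto-x$. - The symmetric monoidal structure is given by the Baer sum, with symmetry $\mathcal{E}+\mathcal{E}'\xrightarrow{\sim}\mathcal{E}'+\mathcal{E}$ given by the swap of the two factors. In particular, both $\pi_0(\mathsf{Coext}(M,\mathcal{A}))$ and $\pi_1(\mathsf{Coext}(M,\mathcal{A})):=\mathrm{Aut}(M\ltimes\mathcal{A})$ are abelian groups.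
   Context: **Systems.** All monoids are commutative, written multiplicatively with unit $1$. A system of abelian groups $\mathcal{A}$ over $M$ consists of an abelian group $\mathcal{A}(a)$ for each $a\in M$ and homomorphisms $r_*:\mathcal{A}(a)\to\mathcal{A}(ra)$ for all $r,a\in M$ with $1_*=\mathrm{id}$ and $(rs)_*=r_*\circ s_*$. A morphism $\alpha:\mathcal{A}\to\mathcal{B}$ is a family of homomorphisms $\alpha(a):\mathcal{A}(a)\to\mathcal{B}(a)$ commuting with all $r_*$; the category is $\mathcal{H}(M)$. A monoid homomorphism $\varphi:M\to M'$ gives $\varphi^*:\mathcal{H}(M')\to\mathcal{H}(M)$, $(\varphi^*\mathcal{A}')(a)=\mathcal{A}'(\varphi(a))$. **Coextensions.** A coextension $0\to\mathcal{A}\to N\xrightarrow{\pi}M\to0$ of $M$ by $\mathcal{A}$ is a surjective monoid homomorphism $\pi:N\to M$ with an action $\bullet$ of the group $\mathcal{A}(m)$ on $\pi^{-1}(m)$ for each $m\in M$ such that (i) for $n,n'\in\pi^{-1}(m)$ there is a unique $x\in\mathcal{A}(m)$ with $n'=x\bullet n$; (ii) $(x\bullet n)(y\bullet n')=(m'_*(x)+m_*(y))\bullet(nn')$ for $x\in\mathcal{A}(m)$, $n\in\pi^{-1}(m)$, $y\in\mathcal{A}(m')$, $n'\in\pi^{-1}(m')$. $\mathsf{Coext}(M,\mathcal{A})$ is the category of coextensions of $M$ by $\mathcal{A}$, a morphism from $\pi:N\to M$ to $\pi':N'\to M$ being a monoid homomorphism $h:N\to N'$ with $\pi'h=\pi$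 and $h(x\bullet n)=x\bullet h(n)$. $\pi_0$ is its set of isomorphism classes. The semidirect product $M\ltimes\mathcal{A}=\{(a,x)\mid a\in M,x\in\mathcal{A}(a)\}$ with $(a,x)(a',x')=(aa',a_*x'+a'_*x)$, projection $(a,x)\mapsto a$ and action $z\bullet(a,x)=(a,z+x)$ is a coextension of $M$ by $\mathcal{A}$. **Pullback.** For $\varphi:N_0\to M$ and a coextension $\pi:L\to M$ by $\mathcal{A}$, $\varphi^*$ of it is $\{(n,l)\in N_0\times L\mid\varphi(n)=\pi(l)\}\to N_0$, a coextension of $N_0$ by $\varphi^*\mathcal{A}$ with action $x\bullet(n,l)=(n,x\bullet l)$. **Push-forward.** For $\alpha:\mathcal{A}\to\mathcal{B}$ in $\mathcal{H}(M)$ and a coextension $\pi:N\to M$ by $\mathcal{A}$, $\alpha_*$ of it is the set of classes $[y,n]$ of pairs with $n\in N$, $y\in\mathcal{B}(\pi(n))$, where $(y,n)\sim(y',n')$ iff $\pi(n)=\pi(n')$ and there is $x\in\mathcal{A}(\pi(n))$ with $x\bullet n=n'$ and $y-\alpha(x)=y'$; the product is $[y,n][z,n']=[\pi(n')_*y+\pi(n)_*z,nn']$, the projection is $[y,n]\mapsto\pi(n)$, and the action is $u\bullet[y,n]=[u+y,n]$. It is a coextension of $M$ by $\mathcal{B}$. **Baer sum.** $\mathcal{E}+\mathcal{E}':=\nabla_*(\Delta^*(\mathcal{E}\times\mathcal{E}'))$, where $\mathcal{E}\times\mathcal{E}'$ is the product coextension $\pi\times\pi':N\times N'\to M\times M$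 (with the group $\mathcal{A}(a)\oplus\mathcal{A}(b)$ acting on the fibre over $(a,b)$), $\Delta:M\to M\times M$ is the diagonal and $\nabla:\mathcal{A}\oplus\mathcal{A}\to\mathcal{A}$ is $(x,y)\mapsto x+y$. **Symmetric categorical group.** A symmetric monoidal groupoid in which every object is invertible up to isomorphism. *)

(* Defs.v *)
From HB Require Import structures.
From mathcomp Require Import all_boot all_algebra.
From mathcomp Require Import boolp.

Set Implicit Arguments.
Unset Strict Implicit.
Unset Printing Implicit Defensive.

Import GRing.Theory.
Local Open Scope ring_scope.
Local Open Scope group_scope.
Local Open Scope quotient_scope.

(* The monoids are multiplicative (%g), the groups A(a) are additive (%R).    *)

HB.mixin Record Magma_isCommutative G of Magma G := {
  mulgC : commutative (@monoid.mul G)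
}.

#[short(type="comMonoidType")]
HB.structure Definition ComMonoid :=
  {G of Monoid G & Magma_isCommutative G}.

Bind Scope group_scope with ComMonoid.sort.

Fact pair_mulgC (G H : comMonoidType) : commutative (@monoid.mul (G * H)%type).
Proof. by move=> [a b] [c d]; congr pair; exact: mulgC. Qed.

HB.instance Definition _ (G H : comMonoidType) :=
  Magma_isCommutative.Build (G * H)%type (@pair_mulgC G H).

Notation "{ 'monhom' G -> H }" := (UMagmaMorphism.type G%type H%type)
  (at level 0, G at level 98, H at level 99,
   format "{ 'monhom'  G  ->  H }") : type_scope.

Lemma monhom_eq (G H : comMonoidType) (f g : {monhom G -> H}) :
  f =1 g -> f = g.
Proof.
case: f g => [f [[f1] [fM]]] [g [[g1] [gM]]] /= /funext fg.
subst g; congr UMagmaMorphism.Pack.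
by rewrite (Prop_irrelevance f1 g1) (Prop_irrelevance fM gM).
Qed.

(* Group elements over provably equal points of M live in different types;    *)
(* castg is the transport between them.                                       *)
Definition castg (M : Type) (A : M -> zmodType) a b (e : a = b) (x : A a) :
  A b := ecast i (A i) e x.

Record system (M : comMonoidType) := System {
  grp :> M -> zmodType;
  push : forall r a, {additive grp a -> grp (r * a)};
  push1 : forall a (x : grp a), castg (mul1g a) (push 1 a x) = x;
  pushM : forall r s a (x : grp a),
    push (r * s) a x = castg (mulgA r s a) (push r (s * a) (push s a x))
}.

Arguments push {M} A r {a} : rename.

(* pushto r e is r_* : A(a) -> A(ra) followed by transport along e : ra = b   *)
Definition pushto (M : comMonoidType) (A : system M) (r a b : M)
  (e : r * a = b) (x : A a) : A b := castg e (push A r x).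

Arguments pushto {M A} r {a b} e x.

Section Cast.
Variables (M : comMonoidType) (A : M -> zmodType).
Implicit Types a b c : M.

Lemma castg_id a (e : a = a) (x : A a) : castg e x = x.
Proof. by rewrite (eq_axiomK e). Qed.

Lemma castg_comp a b c (e : a = b) (e' : b = c) (x : A a) :
  castg e' (castg e x) = castg (etrans e e') x.
Proof. by case: c / e'; case: b / e. Qed.

Lemma castg_irr a b (e e' : a = b) (x : A a) : castg e x = castg e' x.
Proof. by rewrite (eq_irrelevance e e'). Qed.

Fact castg_is_nmod_morphism a b (e : a = b) :
  GRing.nmod_morphism (@castg M A a b e).
Proof. by case: b / e. Qed.

HB.instance Definition _ a b (e : a = b) :=
  GRing.isNmodMorphism.Build (A a) (A b) (@castg M A a b e)
    (castg_is_nmod_morphism e).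

Lemma castg0 a b (e : a = b) : castg e (0 : A a)%R = 0%R.
Proof. exact: (raddf0 (castg e)). Qed.

Lemma castgD a b (e : a = b) (x y : A a) :
  castg e (x + y)%R = (castg e x + castg e y)%R.
Proof. exact: (raddfD (castg e)). Qed.

Lemma castgN a b (e : a = b) (x : A a) : castg e (- x)%R = (- castg e x)%R.
Proof. exact: (raddfN (castg e)). Qed.

End Cast.

Section Push.
Variables (M : comMonoidType) (A : system M).
Implicit Types a b c r s : M.

Fact pushto_is_nmod_morphism r a b (e : r * a = b) :
  GRing.nmod_morphism (@pushto M A r a b e).
Proof.
by split=> [|x y]; rewrite /pushto ?raddf0 // [push _ _ _]raddfD raddfD.
Qed.

HB.instance Definition _ r a b (e : r * a = b) :=
  GRing.isNmodMorphism.Build (A a) (A b) (@pushto M A r a b e)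
    (pushto_is_nmod_morphism e).

Lemma pushto0 r a b (e : r * a = b) : pushto r e (0 : A a)%R = 0%R.
Proof. exact: (raddf0 (pushto r e)). Qed.

Lemma pushtoD r a b (e : r * a = b) (x y : A a) :
  pushto r e (x + y)%R = (pushto r e x + pushto r e y)%R.
Proof. exact: (raddfD (pushto r e)). Qed.

Lemma castgE a b (e : a = b) (x : A a) :
  castg e x = pushto 1 (etrans (mul1g a) e) x.
Proof. by case: b / e; rewrite /pushto -[LHS](push1 x); exact: castg_irr. Qed.

Lemma pushtoE r a (x : A a) : push A r x = pushto r (erefl _) x.
Proof. by []. Qed.

Lemma pushto_eq r r' a b (e : r * a = b) (e' : r' * a = b) (x : A a) :
  r = r' -> pushto r e x = pushto r' e' x.
Proof. by move=> rr'; subst r'; exact: castg_irr. Qed.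

Lemma pushto_comp_proof r s a b c : s * a = b -> r * b = c -> (r * s) * a = c.
Proof. by move=> <- <-; rewrite mulgA. Qed.

Lemma pushto_comp r s a b c (e : s * a = b) (e' : r * b = c) (x : A a) :
  pushto r e' (pushto s e x) = pushto (r * s) (pushto_comp_proof e e') x.
Proof.
case: c / e'; case: b / e; rewrite /pushto pushM castg_comp /=.
by rewrite castg_id.
Qed.

Lemma pushtoN r a b (e : r * a = b) (x : A a) :
  pushto r e (- x)%R = (- pushto r e x)%R.
Proof. exact: (raddfN (pushto r e)). Qed.

Lemma castg_pushto r a b c (e : r * a = b) (e' : b = c) (x : A a) :
  castg e' (pushto r e x) = pushto r (etrans e e') x.
Proof. by case: c / e'; apply: pushto_eq. Qed.

Lemma pushto_castg r a b c (e : a = b) (e' : r * b = c) (x : A a) :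
  pushto r e' (castg e x) = pushto r (etrans (congr1 (monoid.mul r) e) e') x.
Proof. by case: c / e'; case: b / e; apply: pushto_eq. Qed.

Lemma pushto_id a b (e : 1 * a = b) (x : A a) :
  pushto 1 e x = castg (etrans (esym (mul1g a)) e) x.
Proof. by rewrite castgE; exact: pushto_eq. Qed.

End Push.

Record system_hom (M : comMonoidType) (A B : system M) := SystemHom {
  shmap :> forall a, {additive A a -> B a};
  shmap_push : forall r a (x : A a),
    shmap (r * a) (push A r x) = push B r (shmap a x)
}.


Lemma shmap_castg (M : comMonoidType) (A B : system M) (f : system_hom A B)
  a b (e : a = b) (x : A a) : f b (castg e x) = castg e (f a x).
Proof. by case: b / e. Qed.

Lemma shmap_pushto (M : comMonoidType) (A B : system M) (f : system_hom A B)
  r a b (e : r * a = b) (x : A a) : f b (pushto r e x) = pushto r e (f a x).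
Proof. by case: b / e; exact: shmap_push. Qed.

Section PullbackSystem.
Variables (M M' : comMonoidType) (phi : {monhom M -> M'}) (A : system M').

Definition pullback_push r a (x : A (phi a)) : A (phi (r * a)) :=
  pushto (phi r) (esym (gmulfM r a)) x.

Fact pullback_push_is_nmod_morphism r a :
  GRing.nmod_morphism (@pullback_push r a).
Proof. exact: pushto_is_nmod_morphism. Qed.

HB.instance Definition _ r a :=
  GRing.isNmodMorphism.Build (A (phi a)) (A (phi (r * a))) (@pullback_push r a)
    (pullback_push_is_nmod_morphism r a).

Lemma pullback_castg a b (e : a = b) (x : A (phi a)) :
  @castg M (fun c => A (phi c)) a b e x = castg (congr1 phi e) x.
Proof. by case: b / e. Qed.

Fact pullback_push1 a (x : A (phi a)) :
  @castg M (fun c => A (phi c)) _ _ (mul1g a) (pullback_push 1 x) = x.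
Proof.
rewrite pullback_castg castgE pushto_comp -[RHS](castg_id (erefl _)) castgE.
by apply: pushto_eq; rewrite gmulf1 mul1g.
Qed.

Fact pullback_pushM r s a (x : A (phi a)) :
  pullback_push (r * s) x =
  @castg M (fun c => A (phi c)) _ _ (mulgA r s a)
    (pullback_push r (pullback_push s x)).
Proof.
rewrite pullback_castg castgE /pullback_push !pushto_comp.
by apply: pushto_eq; rewrite gmulfM mul1g.
Qed.

Definition pullback_system : system M :=
  @System M (fun a => A (phi a)) (fun r a => @pullback_push r a)
    pullback_push1 pullback_pushM.

End PullbackSystem.

Section SumSystem.
Variables (M M' : comMonoidType) (A : system M) (A' : system M').

Definition sum_push (r a : M * M') (x : A a.1 * A' a.2) :
  A (r * a).1 * A' (r * a).2 := (push A r.1 x.1, push A' r.2 x.2).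

Fact sum_push_is_nmod_morphism r a : GRing.nmod_morphism (@sum_push r a).
Proof. by split=> [|x y]; congr pair; rewrite /= (raddf0, raddfD). Qed.

HB.instance Definition _ r a :=
  GRing.isNmodMorphism.Build (A a.1 * A' a.2)%type
    (A (r * a)%g.1 * A' (r * a)%g.2)%type
    (@sum_push r a) (sum_push_is_nmod_morphism r a).

Lemma sum_castg a b (e : a = b) (x : A a.1 * A' a.2) :
  @castg (M * M')%type (fun c => (A c.1 * A' c.2)%type) a b e x =
  (castg (congr1 fst e) x.1, castg (congr1 snd e) x.2).
Proof. by case: b / e; case: x. Qed.

Fact sum_push1 a (x : A a.1 * A' a.2) :
  @castg (M * M')%type (fun c => (A c.1 * A' c.2)%type) _ _ (mul1g a)
    (sum_push 1 x) = x.
Proof.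
case: x => x y; rewrite sum_castg.
by congr pair; rewrite -[RHS]push1; exact: castg_irr.
Qed.

Fact sum_pushM r s a (x : A a.1 * A' a.2) :
  sum_push (r * s) x =
  @castg (M * M')%type (fun c => (A c.1 * A' c.2)%type) _ _ (mulgA r s a)
    (sum_push r (sum_push s x)).
Proof.
by rewrite sum_castg; congr pair; rewrite [LHS]pushM; exact: castg_irr.
Qed.

Definition sum_system : system (M * M')%type :=
  @System (M * M')%type (fun a => (A a.1 * A' a.2)%type)
    (fun r a => @sum_push r a) sum_push1 sum_pushM.

End SumSystem.

Section Fiber.
Variables (M N : comMonoidType) (pi : {monhom N -> M}).

Definition fiber (m : M) := {n : N | pi n == m}.

Fact fiberM_proof m m' (n : fiber m) (n' : fiber m') :
  pi (val n * val n') == m * m'.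
Proof. by rewrite gmulfM (eqP (valP n)) (eqP (valP n')). Qed.

Definition fiberM m m' (n : fiber m) (n' : fiber m') : fiber (m * m') :=
  exist _ (val n * val n') (fiberM_proof n n').

Definition fiber_of (n : N) : fiber (pi n) := exist _ n (eqxx (pi n)).

Lemma fiberW (P : forall m, fiber m -> Prop) :
  (forall n, P (pi n) (fiber_of n)) -> forall m c, P m c.
Proof.
move=> Pn m [n e]; have em := eqP e; subst m.
by rewrite (bool_irrelevance e (eqxx _)); exact: Pn.
Qed.

End Fiber.

(* In coextM the summand m'_*(x) lives in A(m' m); mulgC moves it to A(m m'). *)
Record coext (M : comMonoidType) (A : system M) := Coext {
  carrier : comMonoidType;
  proj : {monhom carrier -> M};
  proj_surj : forall m, exists n, proj n = m;
  cact : forall m, A m -> fiber proj m -> fiber proj m;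
  cact0 : forall m (n : fiber proj m), cact 0%R n = n;
  cactD : forall m (x y : A m) (n : fiber proj m),
    cact (x + y)%R n = cact x (cact y n);
  cact_torsor : forall m (n n' : fiber proj m), exists! x, n' = cact x n;
  cactM : forall m m' (x : A m) (n : fiber proj m)
                 (y : A m') (n' : fiber proj m'),
    fiberM (cact x n) (cact y n') =
    cact (pushto m' (mulgC m' m) x + push A m y)%R (fiberM n n')
}.

Arguments cact {M A} E {m} x n : rename.
Arguments proj {M A} E : rename.

Definition fiber_map (M N N' : comMonoidType) (pi : {monhom N -> M})
    (pi' : {monhom N' -> M}) (h : N -> N') (hP : forall n, pi' (h n) = pi n)
    m (n : fiber pi m) : fiber pi' m :=
  exist _ (h (val n)) (etrans (congr1 (eq_op^~ m) (hP (val n))) (valP n)).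

Record coext_hom (M : comMonoidType) (A : system M) (E F : coext A) :=
    CoextHom {
  hmap :> {monhom carrier E -> carrier F};
  hmap_proj : forall n, proj F (hmap n) = proj E n;
  hmap_act : forall m (x : A m) (n : fiber (proj E) m),
    fiber_map hmap_proj (cact E x n) = cact F x (fiber_map hmap_proj n)
}.

Section CoextTheory.
Variables (M : comMonoidType) (A : system M) (E : coext A).

Lemma val_cact m m' (e : m = m') (x : A m) (n : fiber (proj E) m)
    (n' : fiber (proj E) m') :
  val n = val n' -> val (cact E x n) = val (cact E (castg e x) n').
Proof. by case: m' / e n' => n' /val_inj ->. Qed.

(* The action read on N itself: tact n x is x acting on n, for x in A(pi(n)). *)
Definition tact (n : carrier E) (x : A (proj E n)) : carrier E :=
  val (cact E x (fiber_of (proj E) n)).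

Lemma proj_tact n (x : A (proj E n)) : proj E (tact x) = proj E n.
Proof. exact: eqP (valP (cact E x (fiber_of (proj E) n))). Qed.

Lemma val_cactE m (x : A m) (c : fiber (proj E) m) :
  val (cact E x c) = tact (castg (esym (eqP (valP c))) x).
Proof. exact: val_cact. Qed.

Lemma tact0 n : @tact n 0 = n.
Proof. by rewrite /tact cact0. Qed.

Lemma tactD n (x y : A (proj E n)) :
  tact (x + y)%R = @tact (tact y) (castg (esym (proj_tact y)) x).
Proof. by rewrite /tact cactD; exact: val_cact. Qed.

Lemma tactM n n' (x : A (proj E n)) (y : A (proj E n')) :
  tact x * tact y =
  @tact (n * n') (pushto (proj E n')
                   (etrans (mulgC _ _) (esym (gmulfM n n'))) x
                + pushto (proj E n) (esym (gmulfM n n')) y)%R.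
Proof.
have /(congr1 val) := cactM x (fiber_of (proj E) n) y (fiber_of (proj E) n').
move=> /= ->; rewrite val_cactE /= raddfD /=; congr (tact (_ + _)%R).
  by rewrite castgE pushto_comp; apply: pushto_eq; rewrite mul1g.
by rewrite pushtoE castgE pushto_comp; apply: pushto_eq; rewrite mul1g.
Qed.

Lemma tact_inj n (x y : A (proj E n)) : tact x = tact y -> x = y.
Proof.
move=> /val_inj xy; have [z [_ zu]] := cact_torsor (fiber_of (proj E) n)
  (cact E x (fiber_of (proj E) n)).
by rewrite -(zu x) // -(zu y).
Qed.

Lemma tact_trans n n' : proj E n = proj E n' -> exists x, n' = @tact n x.
Proof.
move=> e; have n'P : proj E n' == proj E n by rewrite e.
have [x [/(congr1 val) /= xn' _]] :=
  cact_torsor (fiber_of (proj E) n) (exist _ n' n'P).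
by exists x.
Qed.

End CoextTheory.

Arguments tact {M A} E n x.

Section CoextHomTheory.
Variables (M : comMonoidType) (A : system M).
Implicit Types E F G : coext A.

Lemma coext_hom_eq E F (f g : coext_hom E F) : f =1 g -> f = g.
Proof.
case: f g => [f pf af] [g pg ag] /= /monhom_eq fg; subst g.
have ? := Prop_irrelevance pf pg; subst pg.
by rewrite (Prop_irrelevance af ag).
Qed.

Lemma coext_hom_tact E F (f : coext_hom E F) n (x : A (proj E n)) :
  f (tact E n x) = tact F (f n) (castg (esym (hmap_proj f n)) x).
Proof.
have /(congr1 val) /= -> := hmap_act f x (fiber_of (proj E) n).
by rewrite val_cactE; congr tact; exact: castg_irr.
Qed.

Fact hmap_act_of_tact E F (f : {monhom carrier E -> carrier F})
    (pf : forall n, proj F (f n) = proj E n) :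
  (forall n (x : A (proj E n)),
     f (tact E n x) = tact F (f n) (castg (esym (pf n)) x)) ->
  forall m (x : A m) (n : fiber (proj E) m),
    fiber_map pf (cact E x n) = cact F x (fiber_map pf n).
Proof.
move=> fP m x n; apply: val_inj => /=.
rewrite !val_cactE fP /=; congr tact; rewrite castg_comp; exact: castg_irr.
Qed.

Fact coext_id_act E m (x : A m) (n : fiber (proj E) m) :
  fiber_map (h := idfun) (fun=> erefl) (cact E x n) =
  cact E x (fiber_map (h := idfun) (fun=> erefl) n).
Proof.
by apply: val_inj; rewrite /=; congr val; congr cact; exact: val_inj.
Qed.

Definition coext_id E : coext_hom E E :=
  @CoextHom _ _ E E idfun (fun=> erefl) (@coext_id_act E).

Section Comp.
Variables (E F G : coext A) (g : coext_hom F G) (f : coext_hom E F).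

Definition coext_comp_proj n : proj G (g (f n)) = proj E n :=
  etrans (hmap_proj g (f n)) (hmap_proj f n).

Fact coext_comp_act m (x : A m) (n : fiber (proj E) m) :
  fiber_map (h := g \o f) coext_comp_proj (cact E x n) =
  cact G x (fiber_map (h := g \o f) coext_comp_proj n).
Proof.
apply: (hmap_act_of_tact (f := g \o f)) => {}n {}x /=.
by rewrite !coext_hom_tact castg_comp; congr tact; exact: castg_irr.
Qed.

Definition coext_comp : coext_hom E G :=
  @CoextHom _ _ E G (g \o f) coext_comp_proj coext_comp_act.

End Comp.

End CoextHomTheory.

Section Semidirect.
Variables (M : comMonoidType) (A : system M).

Definition sd_type := {a : M & A a}.

HB.instance Definition _ := Choice.on sd_type.

Definition sd_pair (a : M) (x : A a) : sd_type :=
  existT (fun a => A a : Type) a x.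

Definition sd_mul (p q : sd_type) : sd_type :=
  sd_pair (push A (tag p) (tagged q)
            + pushto (tag q) (mulgC (tag q) (tag p)) (tagged p))%R.

Definition sd_one : sd_type := sd_pair (0%R : A 1).

Lemma sd_eq (a b : M) (e : a = b) (x : A a) (y : A b) :
  castg e x = y -> sd_pair x = sd_pair y.
Proof. by case: b / e y => y <-. Qed.

Lemma sd_pair_inj (a : M) : injective (@sd_pair a).
Proof. by move=> x y /eqP; rewrite -tag_eqE /tag_eq eqxx tagged_asE => /eqP. Qed.

Fact sd_mulA : associative sd_mul.
Proof.
move=> [a x] [b y] [c z]; apply: (@sd_eq _ _ (mulgA a b c)).
rewrite /sd_mul /= !pushtoE castgE !pushtoD !pushto_comp -addrA.
congr (_ + _)%R; last congr (_ + _)%R; apply: pushto_eq; rewrite !mul1g //.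
exact: mulgC.
exact: mulgC.
Qed.

Fact sd_mulC : commutative sd_mul.
Proof.
move=> [a x] [b y]; apply: (@sd_eq _ _ (mulgC a b)).
rewrite /= !pushtoE castgE pushtoD !pushto_comp addrC.
by congr (_ + _)%R; apply: pushto_eq; rewrite mul1g.
Qed.

Fact sd_mul1 : left_id sd_one sd_mul.
Proof.
move=> [a x]; apply: (@sd_eq _ _ (mul1g a)); rewrite /= pushto0 addr0.
exact: push1.
Qed.

Fact sd_mulr1 : right_id sd_one sd_mul.
Proof. by move=> x; rewrite sd_mulC sd_mul1. Qed.

HB.instance Definition _ := isMonoid.Build sd_type sd_mulA sd_mul1 sd_mulr1.
HB.instance Definition _ := Magma_isCommutative.Build sd_type sd_mulC.

Definition sd_proj (p : sd_type) : M := tag p.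

HB.instance Definition _ := isMultiplicative.Build sd_type M sd_proj
  (fun _ _ => erefl).
HB.instance Definition _ := Multiplicative_isUMagmaMorphism.Build sd_type M
  sd_proj erefl.

Definition sd_add (p : sd_type) (z : A (sd_proj p)) : sd_type :=
  sd_pair (z + tagged p)%R.

Definition sd_act m (z : A m) (p : fiber sd_proj m) : fiber sd_proj m :=
  exist _ (sd_add (castg (esym (eqP (valP p))) z)) (valP p).

Fact sd_proj_surj m : exists p, sd_proj p = m.
Proof. by exists (sd_pair (0%R : A m)). Qed.

Fact sd_act0 m (p : fiber sd_proj m) : sd_act 0 p = p.
Proof.
apply: val_inj => /=; case: p => [[a x] e] /=.
by congr sd_pair; rewrite /= castg0 add0r.
Qed.

Fact sd_actD m (x y : A m) (p : fiber sd_proj m) :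
  sd_act (x + y)%R p = sd_act x (sd_act y p).
Proof.
apply: val_inj => /=; case: p => [[a z] e] /=.
congr sd_pair; rewrite castgD addrA; congr (_ + _ + _)%R; exact: castg_irr.
Qed.

Fact sd_torsor m (p q : fiber sd_proj m) : exists! x, q = sd_act x p.
Proof.
elim/fiberW: m / p q => -[a x] [[b y] e]; have /= ba := eqP e; subst b.
exists (y - x)%R; split.
  by apply: val_inj; congr sd_pair; rewrite castg_id subrK.
by move=> z /(congr1 val)/sd_pair_inj ->; rewrite castg_id addrK.
Qed.

Fact sd_actM m m' (x : A m) (p : fiber sd_proj m) (y : A m')
    (q : fiber sd_proj m') :
  fiberM (sd_act x p) (sd_act y q) =
  sd_act (pushto m' (mulgC m' m) x + push A m y)%R (fiberM p q).
Proof.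
elim/fiberW: m / p x => -[a z] x; elim/fiberW: m' / q y => -[b t] y.
apply: val_inj; congr sd_pair.
rewrite /= !castg_id !pushtoE !pushtoD [LHS]addrC.
by rewrite [X in _ = (_ + X)%R]addrC [RHS]addrACA.
Qed.

Definition semidirect : coext A :=
  @Coext M A sd_type sd_proj sd_proj_surj sd_act sd_act0 sd_actD
    sd_torsor sd_actM.

End Semidirect.

Section Product.
Variables (M M' : comMonoidType) (A : system M) (A' : system M').
Variables (E : coext A) (E' : coext A').

Definition prod_proj (n : carrier E * carrier E') : M * M' :=
  (proj E n.1, proj E' n.2).

Fact prod_projM : {morph prod_proj : n n' / n * n'}.
Proof. by move=> n n'; congr pair; exact: gmulfM. Qed.

Fact prod_proj1 : prod_proj 1 = 1.
Proof. by congr pair; exact: gmulf1. Qed.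

HB.instance Definition _ := isMultiplicative.Build
  (carrier E * carrier E')%type (M * M')%type prod_proj prod_projM.
HB.instance Definition _ := Multiplicative_isUMagmaMorphism.Build
  (carrier E * carrier E')%type (M * M')%type prod_proj prod_proj1.

Fact prod_fiber1_proof m (n : fiber prod_proj m) : proj E (val n).1 == m.1.
Proof. by have /eqP := valP n => /(congr1 fst) /= ->. Qed.

Fact prod_fiber2_proof m (n : fiber prod_proj m) : proj E' (val n).2 == m.2.
Proof. by have /eqP := valP n => /(congr1 snd) /= ->. Qed.

Definition prod_fiber1 m (n : fiber prod_proj m) : fiber (proj E) m.1 :=
  exist _ (val n).1 (prod_fiber1_proof n).

Definition prod_fiber2 m (n : fiber prod_proj m) : fiber (proj E') m.2 :=
  exist _ (val n).2 (prod_fiber2_proof n).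

Fact prod_fiber_proof m (n : fiber (proj E) m.1) (n' : fiber (proj E') m.2) :
  prod_proj (val n, val n') == m.
Proof. by case: m n n' => a b n n'; rewrite xpair_eqE (valP n) (valP n'). Qed.

Definition prod_fiber m (n : fiber (proj E) m.1) (n' : fiber (proj E') m.2) :
  fiber prod_proj m := exist _ (val n, val n') (prod_fiber_proof n n').

Definition prod_act m (x : sum_system A A' m) (n : fiber prod_proj m) :
  fiber prod_proj m :=
  prod_fiber (cact E x.1 (prod_fiber1 n)) (cact E' x.2 (prod_fiber2 n)).

Fact prod_proj_surj m : exists n, prod_proj n = m.
Proof.
case: m => a b; have [n <-] := proj_surj E a; have [n' <-] := proj_surj E' b.
by exists (n, n').
Qed.

Lemma prod_fiberK m (n : fiber prod_proj m) :
  prod_fiber (prod_fiber1 n) (prod_fiber2 n) = n.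
Proof. by apply: val_inj => /=; case: (sval n). Qed.

Lemma prod_fiber1K m (n : fiber (proj E) m.1) (n' : fiber (proj E') m.2) :
  prod_fiber1 (prod_fiber n n') = n.
Proof. exact: val_inj. Qed.

Lemma prod_fiber2K m (n : fiber (proj E) m.1) (n' : fiber (proj E') m.2) :
  prod_fiber2 (prod_fiber n n') = n'.
Proof. exact: val_inj. Qed.

Fact prod_act0 m (n : fiber prod_proj m) : prod_act 0%R n = n.
Proof. by rewrite /prod_act !cact0 prod_fiberK. Qed.

Fact prod_actD m (x y : sum_system A A' m) (n : fiber prod_proj m) :
  prod_act (x + y)%R n = prod_act x (prod_act y n).
Proof. by rewrite /prod_act prod_fiber1K prod_fiber2K -!cactD. Qed.

Fact prod_torsor m (n n' : fiber prod_proj m) :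
  exists! x : sum_system A A' m, n' = prod_act x n.
Proof.
have [x [xP xu]] := cact_torsor (prod_fiber1 n) (prod_fiber1 n').
have [y [yP yu]] := cact_torsor (prod_fiber2 n) (prod_fiber2 n').
exists (x, y); split; first by rewrite /prod_act /= -xP -yP prod_fiberK.
move=> [x' y'] n'E; rewrite (xu x') ?(yu y') // n'E.
  exact: val_inj.
exact: val_inj.
Qed.

Fact prod_actM m m' (x : sum_system A A' m) (n : fiber prod_proj m)
    (y : sum_system A A' m') (n' : fiber prod_proj m') :
  fiberM (prod_act x n) (prod_act y n') =
  prod_act (pushto m' (mulgC m' m) x + push (sum_system A A') m y)%R
    (fiberM n n').
Proof.
apply: val_inj; rewrite /pushto sum_castg.
have /(congr1 val) E1 := cactM x.1 (prod_fiber1 n) y.1 (prod_fiber1 n').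
have /(congr1 val) E2 := cactM x.2 (prod_fiber2 n) y.2 (prod_fiber2 n').
apply: etrans (congr2 pair E1 E2) _; congr pair; congr val; congr cact.
- by congr (_ + _)%R; exact: castg_irr.
- exact: val_inj.
- by congr (_ + _)%R; exact: castg_irr.
exact: val_inj.
Qed.

Definition prod_coext : coext (sum_system A A') :=
  @Coext (M * M')%type (sum_system A A') (carrier E * carrier E')%type prod_proj
    prod_proj_surj prod_act prod_act0 prod_actD prod_torsor prod_actM.

End Product.

Section Pullback.
Variables (N M : comMonoidType) (phi : {monhom N -> M}).
Variables (A : system M) (E : coext A).

Definition pb_type := {p : N * carrier E | phi p.1 == proj E p.2}.

HB.instance Definition _ := Choice.on pb_type.

Fact pb_mul_proof (p q : pb_type) :
  phi ((val p).1 * (val q).1) == proj E ((val p).2 * (val q).2).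
Proof. by rewrite !gmulfM (eqP (valP p)) (eqP (valP q)). Qed.

Definition pb_mul (p q : pb_type) : pb_type :=
  exist _ ((val p).1 * (val q).1, (val p).2 * (val q).2) (pb_mul_proof p q).

Fact pb_one_proof : phi 1 == proj E 1.
Proof. by rewrite !gmulf1. Qed.

Definition pb_one : pb_type := exist _ (1, 1) pb_one_proof.

Lemma pb_eq (p q : pb_type) :
  (val p).1 = (val q).1 -> (val p).2 = (val q).2 -> p = q.
Proof.
move=> e1 e2; apply: val_inj; move: e1 e2.
by case: (val p) => a b; case: (val q) => c d /= -> ->.
Qed.

Fact pb_mulA : associative pb_mul.
Proof. by move=> p q r; apply: pb_eq; exact: mulgA. Qed.

Fact pb_mulC : commutative pb_mul.
Proof. by move=> p q; apply: pb_eq; exact: mulgC. Qed.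

Fact pb_mul1 : left_id pb_one pb_mul.
Proof. by move=> p; apply: pb_eq; exact: mul1g. Qed.

Fact pb_mulr1 : right_id pb_one pb_mul.
Proof. by move=> p; apply: pb_eq; exact: mulg1. Qed.

HB.instance Definition _ := isMonoid.Build pb_type pb_mulA pb_mul1 pb_mulr1.
HB.instance Definition _ := Magma_isCommutative.Build pb_type pb_mulC.

Definition pb_proj (p : pb_type) : N := (val p).1.

HB.instance Definition _ := isMultiplicative.Build pb_type N pb_proj
  (fun _ _ => erefl).
HB.instance Definition _ := Multiplicative_isUMagmaMorphism.Build pb_type N
  pb_proj erefl.

Fact pb_fiber_proof m (p : fiber pb_proj m) : proj E (val (val p)).2 == phi m.
Proof.
by rewrite -(eqP (valP (val p))); apply/eqP; congr (phi _); exact: eqP (valP p).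
Qed.

Definition pb_fiber m (p : fiber pb_proj m) : fiber (proj E) (phi m) :=
  exist _ (val (val p)).2 (pb_fiber_proof p).

Fact pb_of_fiber_proof m (l : fiber (proj E) (phi m)) :
  phi m == proj E (val l).
Proof. by rewrite eq_sym; exact: (valP l). Qed.

Definition pb_of_fiber m (l : fiber (proj E) (phi m)) : fiber pb_proj m :=
  exist _ (exist _ (m, val l) (pb_of_fiber_proof l) : pb_type) (eqxx m).

Definition pb_act m (x : pullback_system phi A m) (p : fiber pb_proj m) :
  fiber pb_proj m := pb_of_fiber (cact E x (pb_fiber p)).

Lemma pb_fiberK m (p : fiber pb_proj m) : pb_of_fiber (pb_fiber p) = p.
Proof.
by apply: val_inj; apply: pb_eq => //; exact: esym (eqP (valP p)).
Qed.

Lemma pb_of_fiberK m (l : fiber (proj E) (phi m)) :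
  pb_fiber (pb_of_fiber l) = l.
Proof. exact: val_inj. Qed.

Fact pb_proj_surj m : exists p, pb_proj p = m.
Proof.
have [l lm] := proj_surj E (phi m).
have pP : phi (m, l).1 == proj E (m, l).2 by rewrite lm.
by exists (exist _ (m, l) pP).
Qed.

Fact pb_act0 m (p : fiber pb_proj m) : pb_act 0%R p = p.
Proof. by rewrite /pb_act cact0 pb_fiberK. Qed.

Fact pb_actD m (x y : pullback_system phi A m) (p : fiber pb_proj m) :
  pb_act (x + y)%R p = pb_act x (pb_act y p).
Proof. by rewrite /pb_act pb_of_fiberK cactD. Qed.

Fact pb_torsor m (p q : fiber pb_proj m) :
  exists! x : pullback_system phi A m, q = pb_act x p.
Proof.
have [x [xP xu]] := cact_torsor (pb_fiber p) (pb_fiber q).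
exists x; split=> [|y qE]; first by rewrite /pb_act -xP pb_fiberK.
by apply: xu; rewrite qE pb_of_fiberK.
Qed.

Fact pb_actM m m' (x : pullback_system phi A m) (p : fiber pb_proj m)
    (y : pullback_system phi A m') (q : fiber pb_proj m') :
  fiberM (pb_act x p) (pb_act y q) =
  pb_act (pushto m' (mulgC m' m) x + push (pullback_system phi A) m y)%R
    (fiberM p q).
Proof.
apply: val_inj; apply: pb_eq => //.
have /(congr1 val) E1 := @cactM _ _ E (phi m) (phi m') x (pb_fiber p)
  y (pb_fiber q).
apply: (etrans E1).
have F : val (fiberM (pb_fiber p) (pb_fiber q)) = val (pb_fiber (fiberM p q)).
  by [].
rewrite (val_cact (esym (gmulfM m m')) _ F).
congr val; congr cact; rewrite castgD {2}/pushto pullback_castg.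
by congr (_ + _)%R; rewrite ?castg_comp; exact: castg_irr.
Qed.

Definition pullback_coext : coext (pullback_system phi A) :=
  @Coext N (pullback_system phi A) pb_type pb_proj
    pb_proj_surj pb_act pb_act0 pb_actD pb_torsor pb_actM.

End Pullback.

Section Pushforward.
Variables (M : comMonoidType) (A B : system M) (alpha : system_hom A B).
Variable E : coext A.

Definition pf_pre := {n : carrier E & B (proj E n)}.

Definition pf_pair (n : carrier E) (y : B (proj E n)) : pf_pre :=
  existT (fun n => B (proj E n) : Type) n y.

Definition pf_rel (p q : pf_pre) : Prop :=
  exists (e : proj E (tag p) = proj E (tag q)) (x : A (proj E (tag p))),
    val (cact E x (fiber_of (proj E) (tag p))) = tag q /\
    castg e (tagged p - alpha _ x)%R = tagged q.

Lemma pf_pair_eq n n' (en : n = n') (e : proj E n = proj E n')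
    (y : B (proj E n)) (y' : B (proj E n')) :
  castg e y = y' -> pf_pair y = pf_pair y'.
Proof. by case: n' / en e y' => e y' <-; rewrite castg_id. Qed.

Definition pf_shift (p : pf_pre) (x : A (proj E (tag p))) : pf_pre :=
  pf_pair (castg (esym (proj_tact x)) (tagged p - alpha _ x)%R).

Lemma pf_relP p q : pf_rel p q <-> exists x, q = pf_shift (p := p) x.
Proof.
split=> [[e [x [xE yE]]]|[x ->]].
  exists x; case: q => n' y' /= in e xE yE *.
  apply: esym; apply: (pf_pair_eq xE (e := etrans (proj_tact x) e)).
  by rewrite castg_comp -yE; exact: castg_irr.
by exists (esym (proj_tact x)), x.
Qed.

Lemma pf_shift0 p : pf_shift (p := p) 0%R = p.
Proof.
case: p => n y; rewrite /pf_shift /=.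
apply: (pf_pair_eq (tact0 n) (e := congr1 (proj E) (tact0 n))).
by rewrite castg_comp castg_id raddf0 subr0.
Qed.

Lemma pf_shiftD p x y :
  pf_shift (p := p) (x + y)%R =
  pf_shift (p := pf_shift x) (castg (esym (proj_tact x)) y).
Proof.
rewrite addrC /pf_shift /= shmap_castg -[RHS]/(pf_pair _).
have eT := tactD y x; apply: (pf_pair_eq eT (e := congr1 (proj E) eT)).
rewrite (raddfD (alpha _)) opprD !(castgD, castgN) !castg_comp addrA addrAC.
by congr (_ - _ - _)%R; exact: castg_irr.
Qed.

Definition pf_relb (p q : pf_pre) : bool := `[< pf_rel p q >].

Fact pf_relb_refl : reflexive pf_relb.
Proof.
by move=> p; apply/asboolP/pf_relP; exists 0%R; rewrite pf_shift0.
Qed.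

Fact pf_relb_sym : symmetric pf_relb.
Proof.
suff S p q : pf_relb p q -> pf_relb q p by move=> p q; apply/idP/idP; exact: S.
move=> /asboolP/pf_relP[x ->]; apply/asboolP/pf_relP.
exists (castg (esym (proj_tact x)) (- x)%R).
by rewrite -pf_shiftD subrr pf_shift0.
Qed.

Fact pf_relb_trans : transitive pf_relb.
Proof.
move=> q p r /asboolP/pf_relP[x ->] /asboolP/pf_relP[y ->].
apply/asboolP/pf_relP; exists (x + castg (proj_tact x) y)%R.
by rewrite pf_shiftD; congr pf_shift; rewrite castg_comp castg_id.
Qed.

Definition pf_equiv := EquivRel pf_relb pf_relb_refl pf_relb_sym pf_relb_trans.

Definition pf_type := {eq_quot pf_equiv}.

HB.instance Definition _ := Choice.on pf_type.
HB.instance Definition _ := EqQuotient.on pf_type.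

(* the class [y, n], with n determined by the type of y *)
Definition pf_class (n : carrier E) (y : B (proj E n)) : pf_type :=
  \pi_pf_type (pf_pair y).

Lemma pf_classP n (y : B (proj E n)) n' (y' : B (proj E n')) :
  pf_class y = pf_class y' <-> pf_rel (pf_pair y) (pf_pair y').
Proof.
split=> [/eqP|r]; first by rewrite eqmodE => /asboolP.
by apply/eqP; rewrite eqmodE; apply/asboolP.
Qed.

Lemma pf_shiftE p x : \pi_pf_type (pf_shift (p := p) x) = \pi_pf_type p.
Proof.
by apply/esym/eqP; rewrite eqmodE; apply/asboolP/pf_relP; exists x.
Qed.

Lemma pf_reprP p : exists x, repr (\pi_pf_type p) = pf_shift (p := p) x.
Proof.
have : pf_equiv p (repr (\pi_pf_type p)).
  by rewrite -eqmodE reprK.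
by move=> /asboolP/pf_relP.
Qed.

Lemma pf_ind (P : pf_type -> Prop) :
  (forall n y, P (pf_class (n := n) y)) -> forall c, P c.
Proof. by move=> Pc; elim/quotW => -[n y]; exact: Pc. Qed.

Definition pf_op (p q : pf_pre) : pf_pre :=
  pf_pair (n := tag p * tag q)
    (pushto (proj E (tag q)) (etrans (mulgC _ _) (esym (gmulfM _ _))) (tagged p)
     + pushto (proj E (tag p)) (esym (gmulfM _ _)) (tagged q))%R.

Lemma pf_op_shift p q x y : exists z,
  pf_op (pf_shift (p := p) x) (pf_shift (p := q) y) =
  pf_shift (p := pf_op p q) z.
Proof.
case: p x => [n a] x; case: q y => [n' b] y; rewrite /= in x y *.
exists (pushto (proj E n') (etrans (mulgC _ _) (esym (gmulfM _ _))) x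
        + pushto (proj E n) (esym (gmulfM _ _)) y)%R.
have eT := tactM x y.
apply: (pf_pair_eq eT (e := congr1 (proj E) eT)).
rewrite /= (raddfD (alpha _)) !shmap_pushto opprD.
rewrite !(castgD, castgN, pushtoD, pushtoN, castg_pushto, pushto_castg).
rewrite [RHS]addrACA; congr ((_ - _) + (_ - _))%R; apply: pushto_eq;
  by rewrite ?proj_tact.
Qed.

(* Operations on classes are computed on chosen representatives; pf_mulE,     *)
(* pf_projE and pf_actE are the formulas on arbitrary representatives [y, n]. *)
Definition pf_mul (c d : pf_type) : pf_type :=
  \pi_pf_type (pf_op (repr c) (repr d)).

Lemma pf_mulE n (y : B (proj E n)) n' (z : B (proj E n')) :
  pf_mul (pf_class y) (pf_class z) =
  pf_class (n := n * n')
    (pushto (proj E n') (etrans (mulgC _ _) (esym (gmulfM _ _))) y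
     + pushto (proj E n) (esym (gmulfM _ _)) z)%R.
Proof.
have [a ea] := pf_reprP (pf_pair y); have [b eb] := pf_reprP (pf_pair z).
have [c ec] := @pf_op_shift (pf_pair y) (pf_pair z) a b.
by rewrite /pf_mul ea eb ec pf_shiftE.
Qed.

Definition pf_one : pf_type := pf_class (n := 1) 0%R.

Lemma pf_class_eq n n' (en : n = n') (e : proj E n = proj E n')
    (y : B (proj E n)) (y' : B (proj E n')) :
  castg e y = y' -> pf_class y = pf_class y'.
Proof. by move=> ye; rewrite /pf_class (pf_pair_eq en ye). Qed.

Fact pf_mulA : associative pf_mul.
Proof.
elim/pf_ind=> n x; elim/pf_ind=> n' y; elim/pf_ind=> n'' z; rewrite !pf_mulE.
have eM := mulgA n n' n''; apply: (pf_class_eq eM (e := congr1 (proj E) eM)).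
rewrite !castgE !pushtoD !pushto_comp -addrA.
congr (_ + _)%R; last congr (_ + _)%R; apply: pushto_eq; rewrite !mul1g ?gmulfM //.
exact: mulgC.
exact: mulgC.
Qed.

Fact pf_mulC : commutative pf_mul.
Proof.
elim/pf_ind=> n x; elim/pf_ind=> n' y; rewrite !pf_mulE.
have eM := mulgC n n'; apply: (pf_class_eq eM (e := congr1 (proj E) eM)).
rewrite castgE pushtoD !pushto_comp addrC.
by congr (_ + _)%R; apply: pushto_eq; rewrite mul1g.
Qed.

Fact pf_mul1 : left_id pf_one pf_mul.
Proof.
elim/pf_ind=> n x; rewrite pf_mulE.
have eM := mul1g n; apply: (pf_class_eq eM (e := congr1 (proj E) eM)).
rewrite pushto0 add0r castgE pushto_comp -[RHS](castg_id (erefl _)) castgE.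
by apply: pushto_eq; rewrite gmulf1 mul1g.
Qed.

Fact pf_mulr1 : right_id pf_one pf_mul.
Proof. by move=> c; rewrite pf_mulC pf_mul1. Qed.

HB.instance Definition _ := isMonoid.Build pf_type pf_mulA pf_mul1 pf_mulr1.
HB.instance Definition _ := Magma_isCommutative.Build pf_type pf_mulC.

Definition pf_proj (c : pf_type) : M := proj E (tag (repr c)).

Lemma pf_projE n (y : B (proj E n)) : pf_proj (pf_class y) = proj E n.
Proof.
by rewrite /pf_proj; have [x ->] := pf_reprP (pf_pair y); exact: proj_tact.
Qed.

Fact pf_projM : {morph pf_proj : c d / c * d}.
Proof.
elim/pf_ind=> n x; elim/pf_ind=> n' y; rewrite [X in pf_proj X]pf_mulE.
by rewrite !pf_projE gmulfM.
Qed.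

Fact pf_proj1 : pf_proj 1 = 1.
Proof. by rewrite pf_projE gmulf1. Qed.

HB.instance Definition _ := isMultiplicative.Build pf_type M pf_proj pf_projM.
HB.instance Definition _ := Multiplicative_isUMagmaMorphism.Build pf_type M
  pf_proj pf_proj1.

Definition pf_add (c : pf_type) (u : B (pf_proj c)) : pf_type :=
  pf_class (u + tagged (repr c))%R.

Lemma pf_addE n (y : B (proj E n)) (u : B (pf_proj (pf_class y))) :
  pf_add u = pf_class (castg (pf_projE y) u + y)%R.
Proof.
move: (pf_projE y); move: u; rewrite /pf_add /pf_proj.
have [x ->] := pf_reprP (pf_pair y) => /= u e.
apply: etrans (@pf_shiftE (pf_pair (castg e u + y)%R) x).
rewrite /pf_shift /= -/(pf_class _); congr pf_class.
by rewrite !(castgD, castg_comp) castg_id addrA.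
Qed.

Fact pf_act_proof m (u : B m) (c : fiber pf_proj m) :
  pf_proj (pf_add (castg (esym (eqP (valP c))) u)) == m.
Proof. by rewrite pf_projE -[X in X == _]/(pf_proj (val c)) (valP c). Qed.

Definition pf_act m (u : B m) (c : fiber pf_proj m) : fiber pf_proj m :=
  exist _ (pf_add (castg (esym (eqP (valP c))) u)) (pf_act_proof u c).

Lemma pf_actE n (y : B (proj E n)) (u : B (proj E n))
    (e : pf_proj (pf_class y) == proj E n) :
  val (pf_act u (exist _ (pf_class y) e)) = pf_class (u + y)%R.
Proof. by rewrite /= pf_addE castg_comp castg_id. Qed.

Lemma val_pf_act m (u : B m) (c : fiber pf_proj m) n (y : B (proj E n))
    (e : m = proj E n) :
  val c = pf_class y -> val (pf_act u c) = pf_class (castg e u + y)%R.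
Proof.
case: c => c cP /= cE; subst c; rewrite pf_addE castg_comp.
by congr (pf_class (_ + _)%R); exact: castg_irr.
Qed.

Lemma pf_fiberW (P : forall m, fiber pf_proj m -> Prop) :
  (forall n (y : B (proj E n)) (e : pf_proj (pf_class y) == proj E n),
     P (proj E n) (exist _ (pf_class y) e)) ->
  forall m c, P m c.
Proof.
move=> Pc m [c e]; elim/pf_ind: c => n y in e *.
have em : proj E n = m by rewrite -(pf_projE y); exact: eqP e.
by subst m; exact: Pc.
Qed.

Fact pf_proj_surj m : exists c, pf_proj c = m.
Proof.
by have [n <-] := proj_surj E m; exists (pf_class (0%R : B (proj E n)));
  rewrite pf_projE.
Qed.

Fact pf_act0 m (c : fiber pf_proj m) : pf_act 0%R c = c.
Proof.
by elim/pf_fiberW: m / c => n y e; apply: val_inj; rewrite pf_actE add0r.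
Qed.

Fact pf_actD m (u v : B m) (c : fiber pf_proj m) :
  pf_act (u + v)%R c = pf_act u (pf_act v c).
Proof.
elim/pf_fiberW: m / c u v => n y e u v; apply: val_inj.
rewrite pf_actE (val_pf_act _ (erefl _) (pf_actE v e)) castg_id addrA.
by [].
Qed.

Lemma pf_class_inj n : injective (@pf_class n).
Proof.
move=> y y' /pf_classP/pf_relP[x yx].
have xn : tact E n x = n by have /(congr1 tag) := yx.
have x0 : x = 0%R by apply: (@tact_inj _ _ E n); rewrite xn tact0.
rewrite x0 pf_shift0 in yx; apply: esym.
exact: (@eq_from_Tagged _ (fun n => B (proj E n) : Type) n _ _ yx).
Qed.

Fact pf_torsor m (c d : fiber pf_proj m) : exists! u, d = pf_act u c.
Proof.
elim/pf_fiberW: m / c d => n y e [d dP].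
elim/pf_ind: d => n' y' in dP *.
have nn' : proj E n' = proj E n by rewrite -[LHS](pf_projE y'); exact: eqP dP.
have [x xP] := tact_trans nn'.
have yE : pf_class y' =
    pf_class (castg nn' (y' - alpha _ x)%R).
  rewrite -[LHS](@pf_shiftE (pf_pair y') x); subst n.
  by congr pf_class; exact: castg_irr.
exists (castg nn' (y' - alpha _ x) - y)%R; split.
  by apply: val_inj; rewrite pf_actE subrK.
move=> u /(congr1 val); rewrite pf_actE => /= uE.
by rewrite yE in uE; have -> := pf_class_inj uE; rewrite addrK.
Qed.

Fact pf_actM m m' (u : B m) (c : fiber pf_proj m) (v : B m')
    (d : fiber pf_proj m') :
  fiberM (pf_act u c) (pf_act v d) =
  pf_act (pushto m' (mulgC m' m) u + push B m v)%R (fiberM c d).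
Proof.
elim/pf_fiberW: m / c u => n y e u; elim/pf_fiberW: m' / d v => n' z e' v.
apply: val_inj.
pose c : fiber pf_proj (proj E n) := exist _ (pf_class y) e.
pose d : fiber pf_proj (proj E n') := exist _ (pf_class z) e'.
have F : val (fiberM c d) = _ := pf_mulE y z.
rewrite (val_pf_act _ (esym (gmulfM n n')) F).
apply: etrans (congr2 (@monoid.mul pf_type) (pf_actE u e) (pf_actE v e')) _.
rewrite [LHS]pf_mulE; congr pf_class.
rewrite pushtoE castgD !pushtoD !castg_pushto addrACA.
by congr ((_ + _) + _)%R; apply: pushto_eq.
Qed.

Definition pushforward_coext : coext B :=
  @Coext M B pf_type pf_proj pf_proj_surj pf_act pf_act0 pf_actD
    pf_torsor pf_actM.

End Pushforward.

Section ProductMap.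
Variables (M M' : comMonoidType) (A : system M) (A' : system M').
Variables (E F : coext A) (E' F' : coext A').
Variables (f : coext_hom E F) (f' : coext_hom E' F').

Definition prod_map (n : carrier E * carrier E') : carrier F * carrier F' :=
  (f n.1, f' n.2).

Fact prod_mapM : {morph prod_map : n n' / n * n'}.
Proof. by move=> n n'; congr pair; exact: gmulfM. Qed.

Fact prod_map1 : prod_map 1 = 1.
Proof. by congr pair; exact: gmulf1. Qed.

HB.instance Definition _ := isMultiplicative.Build
  (carrier E * carrier E')%type (carrier F * carrier F')%type prod_map prod_mapM.
HB.instance Definition _ := Multiplicative_isUMagmaMorphism.Build
  (carrier E * carrier E')%type (carrier F * carrier F')%type prod_map prod_map1.

Fact prod_map_proj (n : carrier (prod_coext E E')) :
  proj (prod_coext F F') (prod_map n) = proj (prod_coext E E') n.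
Proof. by congr pair; exact: hmap_proj. Qed.

Fact prod_map_act m (x : sum_system A A' m)
    (n : fiber (proj (prod_coext E E')) m) :
  fiber_map (h := prod_map) prod_map_proj (cact (prod_coext E E') x n) =
  cact (prod_coext F F') x (fiber_map (h := prod_map) prod_map_proj n).
Proof.
apply: val_inj; have /(congr1 val) E1 := hmap_act f x.1 (prod_fiber1 n).
have /(congr1 val) E2 := hmap_act f' x.2 (prod_fiber2 n).
apply: etrans (congr2 pair E1 E2) _.
by congr pair; congr val; congr cact; exact: val_inj.
Qed.

Definition prod_hom : coext_hom (prod_coext E E') (prod_coext F F') :=
  @CoextHom _ _ (prod_coext E E') (prod_coext F F') prod_map prod_map_proj
    prod_map_act.

End ProductMap.

Section PullbackMap.
Variables (N M : comMonoidType) (phi : {monhom N -> M}) (A : system M).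
Variables (E F : coext A) (f : coext_hom E F).

Fact pb_map_proof (p : pb_type phi E) : phi (val p).1 == proj F (f (val p).2).
Proof. by rewrite hmap_proj; exact: (valP p). Qed.

Definition pb_map (p : pb_type phi E) : pb_type phi F :=
  exist _ ((val p).1, f (val p).2) (pb_map_proof p).

Fact pb_mapM : {morph pb_map : p q / p * q}.
Proof. by move=> p q; apply: pb_eq => //; exact: gmulfM. Qed.

Fact pb_map1 : pb_map 1 = 1.
Proof. by apply: pb_eq => //; exact: gmulf1. Qed.

HB.instance Definition _ := isMultiplicative.Build
  (pb_type phi E) (pb_type phi F) pb_map pb_mapM.
HB.instance Definition _ := Multiplicative_isUMagmaMorphism.Build
  (pb_type phi E) (pb_type phi F) pb_map pb_map1.

Fact pb_map_proj (p : carrier (pullback_coext phi E)) :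
  proj (pullback_coext phi F) (pb_map p) = proj (pullback_coext phi E) p.
Proof. by []. Qed.

Fact pb_map_act m (x : pullback_system phi A m)
    (p : fiber (proj (pullback_coext phi E)) m) :
  fiber_map (h := pb_map) pb_map_proj (cact (pullback_coext phi E) x p) =
  cact (pullback_coext phi F) x (fiber_map (h := pb_map) pb_map_proj p).
Proof.
apply: val_inj; apply: pb_eq => //.
have /(congr1 val) E1 := @hmap_act _ _ _ _ f (phi m) x (pb_fiber p).
by apply: etrans E1 _; congr val; congr cact; exact: val_inj.
Qed.

Definition pullback_hom :
  coext_hom (pullback_coext phi E) (pullback_coext phi F) :=
  @CoextHom _ _ (pullback_coext phi E) (pullback_coext phi F) pb_map
    pb_map_proj pb_map_act.

End PullbackMap.

(* A monoid homomorphism f over M that is equivariant along tau induces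
   [y, n] |-> [y, f n] on push-forwards along beta \o tau and beta. *)
Section PushforwardMap.
Variables (M : comMonoidType) (A A' B : system M).
Variables (alpha : system_hom A B) (beta : system_hom A' B).
Variables (tau : forall a, A a -> A' a).
Hypothesis tauP : forall a x, beta a (tau x) = alpha a x.
Variables (E : coext A) (F : coext A') (f : {monhom carrier E -> carrier F}).
Hypothesis fP : forall n, proj F (f n) = proj E n.
Hypothesis f_act : forall m (x : A m) (n : fiber (proj E) m),
  fiber_map fP (cact E x n) = cact F (tau x) (fiber_map fP n).

Lemma pfm_tau_castg a b (e : a = b) (x : A a) :
  tau (castg e x) = castg e (tau x).
Proof. by case: b / e. Qed.

Lemma pfm_tact n (x : A (proj E n)) :
  f (tact E n x) = tact F (f n) (castg (esym (fP n)) (tau x)).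
Proof.
have /(congr1 val) /= -> := f_act x (fiber_of (proj E) n).
by rewrite val_cactE; congr tact; exact: castg_irr.
Qed.

Definition pf_map (c : pf_type alpha E) : pf_type beta F :=
  pf_class beta (n := f (tag (repr c))) (castg (esym (fP _)) (tagged (repr c))).

Lemma pf_mapE n (y : B (proj E n)) :
  pf_map (pf_class alpha y) = pf_class beta (castg (esym (fP n)) y).
Proof.
rewrite /pf_map; have [x ->] := pf_reprP alpha (pf_pair y).
pose z := castg (esym (fP n)) (tau x).
apply: etrans _ (pf_shiftE beta (p := pf_pair (castg (esym (fP n)) y)) z).
have eT := pfm_tact x; apply: (pf_class_eq beta eT (e := congr1 (proj F) eT)).
rewrite /= shmap_castg tauP !(castgD, castgN) !castg_comp.
by congr (_ - _)%R; exact: castg_irr.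
Qed.

Fact pf_mapM : {morph pf_map : c d / c * d}.
Proof.
elim/pf_ind=> n y; elim/pf_ind=> n' z.
rewrite [X in pf_map X]pf_mulE !pf_mapE [RHS]pf_mulE.
have eM := gmulfM (s := f) n n'.
apply: (pf_class_eq beta eM (e := congr1 (proj F) eM)).
rewrite !castgD !castg_pushto !pushto_castg.
by congr (_ + _)%R; apply: pushto_eq; rewrite fP.
Qed.

Fact pf_map1 : pf_map 1 = 1.
Proof.
have e1 := gmulf1 (s := f); rewrite [X in pf_map X]/1 /= /pf_one.
rewrite pf_mapE castg0; apply: (pf_class_eq beta e1 (e := congr1 (proj F) e1)).
by rewrite castg0.
Qed.

HB.instance Definition _ := isMultiplicative.Build
  (pf_type alpha E) (pf_type beta F) pf_map pf_mapM.
HB.instance Definition _ := Multiplicative_isUMagmaMorphism.Build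
  (pf_type alpha E) (pf_type beta F) pf_map pf_map1.

Fact pf_map_proj (c : carrier (pushforward_coext alpha E)) :
  proj (pushforward_coext beta F) (pf_map c) =
  proj (pushforward_coext alpha E) c.
Proof.
by elim/pf_ind: c => n y; rewrite pf_mapE [LHS]pf_projE [RHS]pf_projE fP.
Qed.

Fact pf_map_act m (u : B m) (c : fiber (proj (pushforward_coext alpha E)) m) :
  fiber_map (h := pf_map) pf_map_proj (cact (pushforward_coext alpha E) u c) =
  cact (pushforward_coext beta F) u (fiber_map (h := pf_map) pf_map_proj c).
Proof.
elim/(@pf_fiberW _ _ _ alpha): m / c u => n y e u; apply: val_inj.
apply: etrans (congr1 pf_map (pf_actE u e)) _; rewrite pf_mapE.
have F1 : val (fiber_map (h := pf_map) pf_map_proj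
  (exist _ (pf_class alpha y) e : fiber (proj (pushforward_coext alpha E)) _))
  = _ := pf_mapE y.
apply: esym; apply: etrans (val_pf_act u (esym (fP n)) F1) _.
by rewrite castgD.
Qed.

Definition pf_hom_along :
  coext_hom (pushforward_coext alpha E) (pushforward_coext beta F) :=
  @CoextHom _ _ (pushforward_coext alpha E) (pushforward_coext beta F)
    pf_map pf_map_proj pf_map_act.

End PushforwardMap.

Definition pushforward_hom (M : comMonoidType) (A B : system M)
    (alpha : system_hom A B) (E F : coext A) (f : coext_hom E F) :
  coext_hom (pushforward_coext alpha E) (pushforward_coext alpha F) :=
  pf_hom_along (alpha := alpha) (beta := alpha) (tau := fun _ => id)
    (fun _ _ => erefl) (fP := hmap_proj f) (hmap_act f).

Section Baer.
Variables (M : comMonoidType).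

Definition delta (a : M) : M * M := (a, a).

HB.instance Definition _ := isMultiplicative.Build M (M * M)%type delta
  (fun _ _ => erefl).
HB.instance Definition _ := Multiplicative_isUMagmaMorphism.Build
  M (M * M)%type delta erefl.

Variable A : system M.

Definition nabla_fun a (x : pullback_system delta (sum_system A A) a) : A a :=
  (x.1 + x.2)%R.

Fact nabla_fun_is_nmod_morphism a : GRing.nmod_morphism (@nabla_fun a).
Proof. by split=> [|x y]; rewrite /nabla_fun /= ?addr0 // addrACA. Qed.

HB.instance Definition _ a := GRing.isNmodMorphism.Build
  (pullback_system delta (sum_system A A) a) (A a) (@nabla_fun a)
  (@nabla_fun_is_nmod_morphism a).

Fact nabla_push r a (x : pullback_system delta (sum_system A A) a) :
  nabla_fun (push (pullback_system delta (sum_system A A)) r x) =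
  push A r (nabla_fun x).
Proof.
by rewrite [RHS]raddfD.
Qed.

Definition nabla : system_hom (pullback_system delta (sum_system A A)) A :=
  @SystemHom _ (pullback_system delta (sum_system A A)) A
    (fun a => @nabla_fun a) nabla_push.

Definition neg_fun a (x : A a) : A a := (- x)%R.

HB.instance Definition _ a :=
  GRing.Additive.copy (@neg_fun a) (@GRing.opp (A a)).

Fact neg_push r a (x : A a) : neg_fun (push A r x) = push A r (neg_fun x).
Proof. by rewrite /neg_fun raddfN. Qed.

Definition neg : system_hom A A :=
  @SystemHom _ A A (fun a => @neg_fun a) neg_push.

Definition coext_inv (E : coext A) : coext A := pushforward_coext neg E.

Definition baer (E F : coext A) : coext A :=
  pushforward_coext nabla (pullback_coext delta (prod_coext E F)).

Definition baer_hom (E F E' F' : coext A) (f : coext_hom E F)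
    (f' : coext_hom E' F') : coext_hom (baer E E') (baer F F') :=
  pushforward_hom nabla (pullback_hom delta (prod_hom f f')).

Section Swap.
Variables E F : coext A.

Let EF := pullback_coext delta (prod_coext E F).
Let FE := pullback_coext delta (prod_coext F E).

Fact swap_pt_proof (p : pb_type delta (prod_coext E F)) :
  delta (val p).1 == proj (prod_coext F E) ((val p).2.2, (val p).2.1).
Proof. by have /eqP[/eqP e1 /eqP e2] := valP p; rewrite xpair_eqE e1 e2. Qed.

Definition swap_pt (p : pb_type delta (prod_coext E F)) :
    pb_type delta (prod_coext F E) :=
  exist _ ((val p).1, ((val p).2.2, (val p).2.1)) (swap_pt_proof p).

HB.instance Definition _ := isMultiplicative.Build
  (pb_type delta (prod_coext E F)) (pb_type delta (prod_coext F E))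
  swap_pt (fun p q =>
    pb_eq (p := swap_pt (p * q)) (q := swap_pt p * swap_pt q) erefl erefl).
HB.instance Definition _ := Multiplicative_isUMagmaMorphism.Build
  (pb_type delta (prod_coext E F)) (pb_type delta (prod_coext F E))
  swap_pt (pb_eq (p := swap_pt 1) (q := 1) erefl erefl).

Definition swap_coeff a (x : pullback_system delta (sum_system A A) a) :
  pullback_system delta (sum_system A A) a := (x.2, x.1).

Fact nabla_swap a (x : pullback_system delta (sum_system A A) a) :
  nabla a (swap_coeff x) = nabla a x.
Proof. exact: addrC. Qed.

Fact swap_pt_proj (p : carrier EF) : proj FE (swap_pt p) = proj EF p.
Proof. by []. Qed.

Fact swap_pt_act m (x : pullback_system delta (sum_system A A) m)
    (p : fiber (proj EF) m) :
  fiber_map (h := swap_pt) swap_pt_proj (cact EF x p) =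
  cact FE (swap_coeff x) (fiber_map (h := swap_pt) swap_pt_proj p).
Proof.
apply: val_inj; apply: pb_eq => //.
by congr pair; congr val; congr cact; exact: val_inj.
Qed.

Definition baer_swap : coext_hom (baer E F) (baer F E) :=
  pf_hom_along (alpha := nabla) (beta := nabla) nabla_swap
    (fP := swap_pt_proj) swap_pt_act.

Lemma baer_swapE (p : pb_type delta (prod_coext E F)) (y : A (val p).1) :
  baer_swap (pf_class nabla (E := EF) (n := p) y) =
  pf_class nabla (E := FE) (n := swap_pt p) y.
Proof.
by rewrite [LHS](pf_mapE nabla_swap (F := FE) (fP := swap_pt_proj) swap_pt_act)
  castg_id.
Qed.

End Swap.

End Baer.

Record category := Category {
  Ob :> Type;
  Hom : Ob -> Ob -> Type;
  idc : forall a, Hom a a;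
  compc : forall a b c, Hom b c -> Hom a b -> Hom a c;
  compcA : forall a b c d (h : Hom c d) (g : Hom b c) (f : Hom a b),
    compc h (compc g f) = compc (compc h g) f;
  compc1f : forall a b (f : Hom a b), compc (idc b) f = f;
  compcf1 : forall a b (f : Hom a b), compc f (idc a) = f
}.

Arguments Hom {C} a b : rename.
Arguments idc {C} a : rename.
Arguments compc {C a b c} g f : rename.

Definition is_iso (C : category) (a b : C) (f : Hom a b) : Prop :=
  exists g : Hom b a, compc g f = idc a /\ compc f g = idc b.

Definition isomorphic (C : category) (a b : C) : Prop :=
  exists f : Hom a b, is_iso f.

Definition is_groupoid (C : category) : Prop :=
  forall (a b : C) (f : Hom a b), is_iso f.

(* The second hexagon and the compatibility of the symmetry with the unit are *)
(* consequences, because of symK.                                             *)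
Record symmetric_monoidal (C : category) (tens : C -> C -> C)
    (tensm : forall {a b a' b' : C},
       Hom a b -> Hom a' b' -> Hom (tens a a') (tens b b'))
    (unit : C) (sym : forall a b : C, Hom (tens a b) (tens b a)) :=
    SymmetricMonoidal {
  tensm_id : forall a b, tensm (idc a) (idc b) = idc (tens a b);
  tensm_comp : forall a b c a' b' c' (g : Hom b c) (f : Hom a b)
      (g' : Hom b' c') (f' : Hom a' b'),
    tensm (compc g f) (compc g' f') =
    compc (tensm g g') (tensm f f');
  assoc : forall a b c, Hom (tens (tens a b) c) (tens a (tens b c));
  assoc_iso : forall a b c, is_iso (assoc a b c);
  assoc_nat : forall a b c a' b' c' (f : Hom a a') (g : Hom b b') (h : Hom c c'),
    compc (assoc a' b' c') (tensm (tensm f g) h) =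
    compc (tensm f (tensm g h)) (assoc a b c);
  lunit : forall a, Hom (tens unit a) a;
  lunit_iso : forall a, is_iso (lunit a);
  lunit_nat : forall a b (f : Hom a b),
    compc (lunit b) (tensm (idc unit) f) = compc f (lunit a);
  runit : forall a, Hom (tens a unit) a;
  runit_iso : forall a, is_iso (runit a);
  runit_nat : forall a b (f : Hom a b),
    compc (runit b) (tensm f (idc unit)) = compc f (runit a);
  sym_nat : forall a b a' b' (f : Hom a a') (g : Hom b b'),
    compc (sym a' b') (tensm f g) =
    compc (tensm g f) (sym a b);
  symK : forall a b, compc (sym b a) (sym a b) = idc (tens a b);
  pentagon : forall a b c d,
    compc (assoc a b (tens c d)) (assoc (tens a b) c d) =
    compc (tensm (idc a) (assoc b c d))
      (compc (assoc a (tens b c) d) (tensm (assoc a b c) (idc d)));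
  triangle : forall a b,
    compc (tensm (idc a) (lunit b)) (assoc a unit b) =
    tensm (runit a) (idc b);
  hexagon : forall a b c,
    compc (assoc b c a) (compc (sym a (tens b c)) (assoc a b c)) =
    compc (tensm (idc b) (sym a c))
      (compc (assoc b a c) (tensm (sym a b) (idc c)))
}.

Definition is_symmetric_categorical_group (C : category) (tens : C -> C -> C)
    (tensm : forall {a b a' b' : C},
       Hom a b -> Hom a' b' -> Hom (tens a a') (tens b b'))
    (unit : C) (inv : C -> C)
    (sym : forall a b : C, Hom (tens a b) (tens b a)) : Prop :=
  [/\ is_groupoid C,
      inhabited (symmetric_monoidal (@tensm) unit sym) &
      forall a, isomorphic (tens a (inv a)) unit /\
                isomorphic (tens (inv a) a) unit].

(* The classes of objects of a large category do not fit in the universe of   *)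
(* zmodType, hence the unbundled notion of abelian group.                     *)
Definition is_abelian_group (T : Type) (op : T -> T -> T) (e : T) : Prop :=
  [/\ associative op, commutative op, left_id e op &
      forall x, exists y, op y x = e].

Definition pi0 (C : category) : Type :=
  {P : C -> Prop | exists a, P = isomorphic a}.

Definition pi0_class (C : category) (a : C) : pi0 C :=
  exist _ (isomorphic a) (ex_intro _ a erefl).

Definition aut (C : category) (a : C) : Type := {f : Hom a a | is_iso f}.

Fact aut_comp_proof (C : category) (a : C) (g f : aut a) :
  is_iso (compc (sval g) (sval f)).
Proof.
case: g f => [g [g' [g'g gg']]] [f [f' [f'f ff']]]; exists (compc f' g').
by split; rewrite /= -compcA; rewrite [X in compc _ X]compcA ?(g'g, ff') compc1f.
Qed.

Definition aut_comp (C : category) (a : C) (g f : aut a) : aut a :=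
  exist _ (compc (sval g) (sval f)) (aut_comp_proof g f).

Fact aut_one_proof (C : category) (a : C) : is_iso (idc a).
Proof. by exists (idc a); rewrite compc1f. Qed.

Definition aut_one (C : category) (a : C) : aut a :=
  exist _ (idc a) (aut_one_proof a).

Section CoextCategory.
Variables (M : comMonoidType) (A : system M).

Fact coext_compA (E F G H : coext A) (h : coext_hom G H) (g : coext_hom F G)
    (f : coext_hom E F) :
  coext_comp h (coext_comp g f) = coext_comp (coext_comp h g) f.
Proof. exact: coext_hom_eq. Qed.

Fact coext_comp1f (E F : coext A) (f : coext_hom E F) :
  coext_comp (coext_id F) f = f.
Proof. exact: coext_hom_eq. Qed.

Fact coext_compf1 (E F : coext A) (f : coext_hom E F) :
  coext_comp f (coext_id E) = f.
Proof. exact: coext_hom_eq. Qed.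

Definition Coext_category : category :=
  @Category (coext A) (@coext_hom M A) (@coext_id M A) (@coext_comp M A)
    coext_compA coext_comp1f coext_compf1.

End CoextCategory.

(* Main.v *)
Require Import Defs.
From HB Require Import structures.
From mathcomp Require Import all_boot all_algebra.
From mathcomp Require Import boolp.

(** Over each point of M the fibres of a coextension are torsors, and a
    homomorphism of coextensions is an equivariant map between them over M.
    Such a map is bijective and its inverse is again a homomorphism
    ([coext_hom_is_iso]), so every morphism of the category is invertible.

    Since the addition A + A -> A is onto, every element of a Baer sum E + F is
    the class [0, (n, n')] of a pair of elements lying over the same point of M.
    Write n * n' for it ([bp n n'] below). The whole proof rests on the
    calculus of these symbols: they multiply componentwise ([bpM]), a
    coefficient may be moved across them, (x n) * n' = x (n * n') = n * (x n')
    ([bp_act]), and two symbols coincide only when they differ by moving one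
    coefficient across ([bp_inj]). Thus E + F is a tensor product of torsors,
    and its structural maps are the expected ones:
      - the associator (e * f) * g |-> e * (f * g), well defined by [bp_inj]
        used twice ([baer_assoc]);
      - the unitor, inverse to n |-> (a, 0) * n for n over a ([baer_lunit]);
      - the swap n * n' |-> n' * n.
    Naturality and coherence hold because both sides agree on symbols.

    For the inverse, let j n = [0, n] in the push-forward of E along negation,
    so that j (x n) = (- x) (j n). Then n * j n depends only on the point of M
    below n, and this gives a multiplicative section of E + E^-1; such a section
    extends equivariantly to a homomorphism from the semidirect product
    ([baer_coext_inv], [hom_of_section]).

    The statements on pi_0 and pi_1 hold in every symmetric categorical group:
    pi_0 inherits its axioms from the associator, the unitor and the symmetry,
    and the endomorphisms of the unit commute by the Eckmann-Hilton argument
    ([unit_endo_comm]). *)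

Set Implicit Arguments.
Unset Strict Implicit.
Unset Printing Implicit Defensive.

Import GRing.Theory.
Local Open Scope ring_scope.
Local Open Scope group_scope.

(** * The action on the total monoid, and morphisms of coextensions *)

Section Action.
Variables (M : comMonoidType) (A : system M).
Implicit Types E F G : coext A.

(** Extending the action of A m by the identity outside the fibre over m gives
    functions of untyped points: composites of actions then involve no
    transport between the groups A m for provably equal m, and most identities
    hold without a hypothesis on the fibre. *)
Definition act E m (x : A m) (n : carrier E) : carrier E :=
  if (insub n : option (fiber (proj E) m)) is Some c then val (cact E x c)
  else n.

Lemma act_val E m (x : A m) (c : fiber (proj E) m) :
  act x (val c) = val (cact E x c).
Proof. by rewrite /act valK. Qed.

Lemma act_out E m (x : A m) (n : carrier E) : proj E n != m -> act x n = n.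
Proof. by move=> nm; rewrite /act insubN. Qed.

Lemma act_tact E (n : carrier E) (x : A (proj E n)) : act x n = tact E n x.
Proof. exact: (act_val x (fiber_of (proj E) n)). Qed.

Lemma proj_act E m (x : A m) (n : carrier E) : proj E (act x n) = proj E n.
Proof.
have [/eqP e|/act_out -> //] := boolP (proj E n == m).
by subst m; rewrite act_tact proj_tact.
Qed.

Lemma act0 E m (n : carrier E) : act (0%R : A m) n = n.
Proof.
have [/eqP e|/act_out -> //] := boolP (proj E n == m).
by subst m; rewrite act_tact tact0.
Qed.

Lemma actD E m (x y : A m) (n : carrier E) :
  act (x + y)%R n = act x (act y n).
Proof.
have [e|ne] := boolP (proj E n == m); last by rewrite !act_out ?proj_act.
by rewrite -[n]/(val (exist _ n e : fiber (proj E) m)) !act_val cactD.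
Qed.

Lemma actC E m m' (x : A m) (y : A m') (n : carrier E) :
  act x (act y n) = act y (act x n).
Proof.
have [xm|xm] := eqVneq (proj E n) m; last by rewrite !(act_out x) ?proj_act.
have [ym|ym] := eqVneq (proj E n) m'; last by rewrite !(act_out y) ?proj_act.
by rewrite -xm in x *; rewrite -ym in y *; rewrite -!actD addrC.
Qed.

Lemma actK E m (x : A m) (n : carrier E) : act x (act (- x)%R n) = n.
Proof. by rewrite -actD subrr act0. Qed.

Lemma act_mul E m m' (x : A m) (y : A m') (n n' : carrier E) :
  proj E n = m -> proj E n' = m' ->
  act x n * act y n' =
  act (pushto m' (mulgC m' m) x + push A m y)%R (n * n').
Proof.
move=> /eqP e /eqP e'; pose c : fiber (proj E) m := exist _ n e.
pose c' : fiber (proj E) m' := exist _ n' e'.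
rewrite (act_val x c) (act_val y c') (act_val _ (fiberM c c')) -cactM.
by [].
Qed.

Lemma act_trans E (n n' : carrier E) :
  proj E n = proj E n' -> exists x : A (proj E n), n' = act x n.
Proof. by move=> /tact_trans[x ->]; exists x; rewrite act_tact. Qed.

Lemma act_inj E (n : carrier E) (x y : A (proj E n)) :
  act x n = act y n -> x = y.
Proof. by rewrite !act_tact; apply: tact_inj. Qed.

Lemma hom_act E F (f : coext_hom E F) m (x : A m) n :
  f (act x n) = act x (f n).
Proof.
have [e|ne] := boolP (proj E n == m); last by rewrite !act_out ?hmap_proj.
have /(congr1 val) /= := hmap_act f x (exist _ n e : fiber (proj E) m).
by rewrite -!act_val.
Qed.

Lemma hom_of_fun E F (f : carrier E -> carrier F) :
  (forall n, proj F (f n) = proj E n) -> f 1 = 1 -> {morph f : n k / n * k} ->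
  (forall m (x : A m) n, proj E n = m -> f (act x n) = act x (f n)) ->
  exists h : coext_hom E F, h =1 f.
Proof.
move=> fP f1 fM fA.
pose f' : {monhom carrier E -> carrier F} := HB.pack f
  (isMultiplicative.Build _ _ f fM)
  (Multiplicative_isUMagmaMorphism.Build _ _ f f1).
have f'A m (x : A m) (n : fiber (proj E) m) :
    fiber_map (h := f') fP (cact E x n) = cact F x (fiber_map (h := f') fP n).
  by apply: val_inj; rewrite -act_val /= -act_val fA //; exact: eqP (valP n).
by exists (@CoextHom _ _ E F f' fP f'A).
Qed.

(** Natural maps out of a Baer sum are prescribed on symbols n * n', which do
    not determine n and n'; their graphs are available before the maps are. *)
Lemma hom_of_graph E F (R : carrier E -> carrier F -> Prop) :
  (forall n, exists k, R n k) ->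
  (forall n k k', R n k -> R n k' -> k = k') ->
  (forall n k, R n k -> proj F k = proj E n) ->
  R 1 1 -> (forall n k n' k', R n k -> R n' k' -> R (n * n') (k * k')) ->
  (forall m (x : A m) n k, R n k -> R (act x n) (act x k)) ->
  exists h : coext_hom E F, forall n, R n (h n).
Proof.
move=> Rex Rfun Rproj R1 RM RA; have [f fR] := choice Rex.
have [|||m x n _|h hf] := @hom_of_fun E F f.
- by move=> n; exact: Rproj.
- exact: Rfun R1.
- by move=> n k; apply: Rfun (RM _ _ _ _ (fR n) (fR k)).
- exact: Rfun (RA _ _ _ _ (fR n)).
by exists h => n; rewrite hf.
Qed.

(** An equivariant map of torsors is bijective: if f (x n) = f n then x fixes
    f n, hence x = 0, and an element over the same point as f n has the form
    x (f n) = f (x n). The inverse graph is closed under the structure. *)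
Lemma coext_hom_is_iso E F (f : coext_hom E F) :
  @is_iso (Coext_category A) E F f.
Proof.
have finj n n' : f n = f n' -> n = n'.
  move=> e; have [|x n'E] := @act_trans E n n'.
    by rewrite -(hmap_proj f n) e hmap_proj.
  rewrite n'E hom_act in e *.
  suff -> : x = 0%R by rewrite act0.
  (* The coefficient lives in A (proj E n); injectivity of the action at f n
     expects it in A (proj F (f n)). *)
  move: e; rewrite -[f n in LHS](act0 (proj E n)).
  by move: x {n'E}; rewrite -(hmap_proj f n) => x /act_inj.
have [||||||g gP] := @hom_of_graph F E (fun k n => f n = k).
- move=> k; have [n nk] := proj_surj E (proj F k).
  have [|x ->] := @act_trans F (f n) k; first by rewrite hmap_proj.
  by exists (act x n); rewrite hom_act.
- by move=> k n n' <- /esym/finj.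
- by move=> k n <-; rewrite hmap_proj.
- exact: gmulf1.
- by move=> n k n' k' <- <-; exact: gmulfM.
- by move=> m x k n <-; exact: hom_act.
exists g; split; apply: coext_hom_eq => n /=; last exact: gP.
by apply: finj; rewrite gP.
Qed.

End Action.

(** * The semidirect product *)

Section Semidirect.
Variables (M : comMonoidType) (A : system M).

Definition sd_zero (a : M) : carrier (semidirect A) := sd_pair (0%R : A a).

Lemma sd_zeroM a b : sd_zero (a * b) = sd_zero a * sd_zero b.
Proof. by congr sd_pair; rewrite /= raddf0 pushto0 addr0. Qed.

Lemma sd_act_zero a (x : A a) : act x (sd_zero a) = sd_pair x.
Proof.
rewrite (act_tact (E := semidirect A) (n := sd_zero a) x).
by congr sd_pair; rewrite castg_id addr0.
Qed.

(** A multiplicative section s trivialises G through (a, x) |-> x (s a), by the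
    compatibility of the action with products. *)
Lemma hom_of_section (G : coext A) (s : M -> carrier G) :
  (forall a, proj G (s a) = a) -> s 1 = 1 -> {morph s : a b / a * b} ->
  inhabited (coext_hom (semidirect A) G).
Proof.
move=> sP s1 sM.
have [|||m x [a y] e|h _] := @hom_of_fun _ _ (semidirect A) G
    (fun p => act (tagged p) (s (tag p))); last by exists.
- by move=> n; rewrite proj_act sP.
- by rewrite act0.
- move=> [a x] [b y] /=; rewrite (act_mul x y (sP a) (sP b)) -sM.
  by rewrite addrC.
rewrite /= in e; subst m.
by rewrite (act_tact (E := semidirect A) (n := sd_pair y) x) /= castg_id actD.
Qed.

End Semidirect.

(** * Points of a push-forward *)

Section PushforwardPoints.
Variables (M : comMonoidType) (A B : system M) (alpha : system_hom A B).
Variable E : coext A.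
Let F := pushforward_coext alpha E.

Definition pf_of (n : carrier E) : carrier F := pf_class alpha (n := n) 0%R.

Lemma proj_pf_of n : proj F (pf_of n) = proj E n.
Proof. exact: pf_projE. Qed.

Lemma pf_ofM : {morph pf_of : n k / n * k}.
Proof. by move=> n k; apply: esym; rewrite [LHS]pf_mulE !pushto0 addr0. Qed.

(** The relation (y, n) ~ (y - alpha x, x n), taken at y = alpha x. *)
Lemma pf_of_act m (x : A m) n : pf_of (act x n) = act (alpha m x) (pf_of n).
Proof.
have [/eqP e|ne] := boolP (proj E n == m); last first.
  by rewrite !act_out ?proj_pf_of.
subst m; have cP : proj F (pf_of n) == proj E n by rewrite proj_pf_of.
rewrite (act_val (alpha _ x)
  (exist _ (pf_of n) cP : fiber (proj F) (proj E n))).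
rewrite [RHS]pf_actE addr0.
rewrite -[RHS](@pf_shiftE _ _ _ alpha E (pf_pair _) x) act_tact.
by rewrite /pf_shift /= subrr castg0.
Qed.

(** If alpha is onto, any [y, n] = [alpha x, n] equals [0, x n]. *)
Lemma pf_of_surj (c : carrier F) :
  (forall a y, exists x, alpha a x = y) -> exists n, c = pf_of n.
Proof.
move=> asurj; elim/pf_ind: c => n y.
have [x xy] := asurj _ y; exists (act x n).
have cP : proj F (pf_of n) == proj E n by rewrite proj_pf_of.
rewrite pf_of_act
  (act_val _ (exist _ (pf_of n) cP : fiber (proj F) (proj E n))).
by rewrite [RHS]pf_actE addr0 xy.
Qed.

Lemma pf_of_inj n k : pf_of n = pf_of k ->
  exists x : A (proj E n), alpha _ x = 0%R /\ k = act x n.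
Proof.
move=> /pf_classP[/= e [x [kE xE]]]; exists x; split; last by rewrite act_tact.
apply: oppr_inj; rewrite -[LHS]add0r oppr0.
move: xE; move: (0 - _)%R => z /(congr1 (castg (esym e))).
by rewrite castg_comp castg_id castg0.
Qed.

End PushforwardPoints.

Lemma pushforward_hom_pf_of (M : comMonoidType) (A B : system M)
    (alpha : system_hom A B) (E F : coext A) (f : coext_hom E F) n :
  pushforward_hom alpha f (pf_of alpha n) = pf_of alpha (f n).
Proof.
rewrite [LHS](pf_mapE (tau := fun _ => id) (fun _ _ => erefl) (hmap_act f)).
by rewrite castg0.
Qed.

(** * The calculus of symbols in a Baer sum *)

Section BaerPoints.
Variables (M : comMonoidType) (A : system M).
Implicit Types E F G : coext A.

(** The symbol n * n' = [0, (n, n')]. It is made total, with value 1 when n and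
    n' lie over different points, so that it can be iterated without carrying
    proofs of compatibility inside the terms. *)
Definition bp E F (n : carrier E) (n' : carrier F) : carrier (baer E F) :=
  if insub (proj E n, (n, n')) is Some p
  then pf_of (nabla A) (E := pullback_coext (@delta M) (prod_coext E F)) p
  else 1.

Section Points.
Variables E F : coext A.
Let EF := pullback_coext (@delta M) (prod_coext E F).

Lemma bp_val (p : pb_type (@delta M) (prod_coext E F)) :
  bp (val p).2.1 (val p).2.2 = pf_of (nabla A) (E := EF) p.
Proof.
have /eqP[e1 _] := valP p; rewrite /bp.
suff -> : (proj E (val p).2.1, ((val p).2.1, (val p).2.2)) = val p.
  by rewrite valK.
by rewrite -e1 /=; case: (sval p) => a [n n'].
Qed.

Lemma bp_pt (n : carrier E) (n' : carrier F) : proj E n = proj F n' ->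
  exists p : carrier EF, val p = (proj E n, (n, n')).
Proof.
move=> e.
have eP : delta (proj E n) == proj (prod_coext E F) (n, n').
  by rewrite xpair_eqE /= e eqxx.
by exists (exist (fun p => delta p.1 == proj (prod_coext E F) p.2)
             (proj E n, (n, n')) eP).
Qed.

Lemma act_pt m (x y : A m) (p : carrier EF) :
  val (act (E := EF) (m := m) (x, y) p) =
  ((val p).1, (act x (val p).2.1, act y (val p).2.2)).
Proof.
have /eqP[e1 e2] := valP p.
have [/eqP e|ne] := boolP (proj EF p == m); last first.
  rewrite !act_out // -?e1 -?e2 //.
  by rewrite /=; case: (sval p) => a [n n'].
by subst m; rewrite act_tact /tact /= -!act_val.
Qed.

Lemma proj_bp n n' :
  proj E n = proj F n' -> proj (baer E F) (bp n n') = proj E n.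
Proof.
move=> /bp_pt[p pE].
have := bp_val p; rewrite pE /= => ->; rewrite proj_pf_of.
by rewrite -[LHS]/((val p).1) pE.
Qed.

Lemma bp1 : bp (1 : carrier E) (1 : carrier F) = 1.
Proof. exact: (bp_val 1). Qed.

Lemma bpM n k n' k' : proj E n = proj F k -> proj E n' = proj F k' ->
  bp n k * bp n' k' = bp (n * n') (k * k').
Proof.
move=> /bp_pt[p pE] /bp_pt[q qE].
have := bp_val p; have := bp_val q; have := bp_val (p * q).
by rewrite /= pE qE /= => -> -> ->; rewrite pf_ofM.
Qed.

Lemma bp_act m (x y : A m) n n' : proj E n = proj F n' ->
  bp (act x n) (act y n') = act (x + y)%R (bp n n').
Proof.
move=> /bp_pt[p pE].
have := bp_val p; have := bp_val (act (E := EF) (m := m) (x, y) p).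
by rewrite act_pt pE /= => -> ->; rewrite pf_of_act.
Qed.

Lemma bp_actl m (x : A m) n n' : proj E n = proj F n' ->
  bp (act x n) n' = act x (bp n n').
Proof. by move=> e; rewrite -{1}(act0 m n') bp_act // addr0. Qed.

Lemma bp_actr m (x : A m) n n' : proj E n = proj F n' ->
  bp n (act x n') = act x (bp n n').
Proof. by move=> e; rewrite -{1}(act0 m n) bp_act // add0r. Qed.

Lemma bp_surj (c : carrier (baer E F)) :
  exists n n', proj E n = proj F n' /\ c = bp n n'.
Proof.
have [a y|p ->] := pf_of_surj c; first by exists (y, 0)%R; exact: addr0.
exists (val p).2.1, (val p).2.2; rewrite bp_val; split=> //.
by have /eqP[<- <-] := valP p.
Qed.

(** Symbols are equal only up to the kernel of the addition A + A -> A, and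
    this kernel consists of the pairs (x, - x). *)
Lemma bp_inj n n' k k' : proj E n = proj F n' -> proj E k = proj F k' ->
  bp n n' = bp k k' ->
  exists x : A (proj E n), k = act x n /\ k' = act (- x)%R n'.
Proof.
move=> /bp_pt[p pE] /bp_pt[q qE].
have := bp_val p; have := bp_val q; rewrite pE qE /= => -> -> /pf_of_inj[x].
have : proj EF p = proj E n by rewrite -[LHS]/((val p).1) pE.
case: x => x y; move: (proj _ _) x y => m x y em; subst m => -[xy].
move=> /(congr1 val); rewrite act_pt pE qE => -[_ kE k'E].
exists x; split=> //; rewrite k'E; congr act.
by apply/eqP; rewrite -addr_eq0 addrC; apply/eqP.
Qed.

End Points.

Lemma baer_homE E F E' F' (f : coext_hom E F) (f' : coext_hom E' F') n n' :
  proj E n = proj E' n' ->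
  baer_hom f f' (bp n n') = bp (f n) (f' n').
Proof.
move=> /bp_pt[p pE].
have := bp_val p; have := bp_val (pullback_hom (@delta M) (prod_hom f f') p).
rewrite pE /= pE /= => -> ->.
exact: (pushforward_hom_pf_of (nabla A)
  (pullback_hom (@delta M) (prod_hom f f')) p).
Qed.

Lemma baer_swap_bp E F (n : carrier E) (n' : carrier F) :
  proj E n = proj F n' -> baer_swap E F (bp n n') = bp n' n.
Proof.
move=> /bp_pt[p pE].
have := bp_val p; have := bp_val (swap_pt p).
rewrite /= pE /= => -> ->.
by rewrite [LHS]baer_swapE.
Qed.

End BaerPoints.

(** * The symmetric monoidal structure *)

Section MonoidalStructure.
Variables (M : comMonoidType) (A : system M).
Implicit Types E F G : coext A.

(** If (e * f) * g = (e' * f') * g', then g' = - x g and e' * f' = x (e * f),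
    so that e' = y (x e) and f' = - y f. In e' * (f' * g') the coefficients
    come out in front and cancel. *)
Lemma baer_assoc E F G :
  exists h : coext_hom (baer (baer E F) G) (baer E (baer F G)),
  forall e f g, proj E e = proj F f -> proj F f = proj G g ->
    h (bp (bp e f) g) = bp e (bp f g).
Proof.
pose R (c : carrier (baer (baer E F) G)) (d : carrier (baer E (baer F G))) :=
  exists e f g, [/\ proj E e = proj F f, proj F f = proj G g,
    c = bp (bp e f) g & d = bp e (bp f g)].
have Rfun c d d' : R c d -> R c d' -> d = d'.
  move=> [e [f [g [ef fg -> ->]]]] [e' [f' [g' [e'f' f'g' cE ->]]]].
  have [||x [/esym efE ->]] := bp_inj _ _ cE; rewrite ?proj_bp ?ef ?e'f' //.
  rewrite -bp_actl // in efE.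
  have [||y [-> ->]] := bp_inj _ _ efE; rewrite ?proj_act //.
  do !rewrite (bp_actl, bp_actr) ?proj_act ?proj_bp ?proj_act //.
    by rewrite (actC x) !actK.
  by apply: etrans (proj_act _ _) _; rewrite !proj_act proj_bp.
have [|||||h hR] := @hom_of_graph _ _ _ _ R _ Rfun.
- move=> c; have [d [g [dg ->]]] := bp_surj c.
  have [e [f [ef dE]]] := bp_surj d.
  exists (bp e (bp f g)), e, f, g; split=> //; last by rewrite dE.
  by rewrite -dg dE proj_bp.
- by move=> c d [e [f [g [ef fg -> ->]]]]; rewrite !proj_bp // ef.
- by exists 1, 1, 1; rewrite !gmulf1 !bp1.
- move=> _ _ _ _ [e [f [g [ef fg -> ->]]]] [e' [f' [g' [e'f' f'g' -> ->]]]].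
  by exists (e * e'), (f * f'), (g * g');
    rewrite !bpM ?proj_bp ?gmulfM ?ef ?e'f' ?fg ?f'g'.
- move=> m x _ _ [e [f [g [ef fg -> ->]]]]; exists (act x e), f, g.
  by rewrite !bp_actl ?proj_act ?proj_bp ?ef.
exists h => e f g ef fg; apply: Rfun (hR _) _; by exists e, f, g.
Qed.

(** The map n |-> (a, 0) * n, for n over a, is a homomorphism since a |-> (a, 0)
    is multiplicative; its inverse is the unitor. *)
Lemma baer_lunit E : exists h : coext_hom (baer (semidirect A) E) E,
  forall n, h (bp (sd_zero A (proj E n)) n) = n.
Proof.
have [||||h hE] := @hom_of_fun _ _ E (baer (semidirect A) E)
  (fun n => bp (sd_zero A (proj E n)) n).
- by move=> n; rewrite proj_bp.
- by rewrite gmulf1 bp1.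
- by move=> n k; rewrite bpM // -sd_zeroM gmulfM.
- by move=> m x n _; rewrite proj_act bp_actr.
have [g [gh _]] := coext_hom_is_iso h.
exists g => n; rewrite -hE; exact: (congr1 (fun k : coext_hom E E => k n) gh).
Qed.

Lemma baer_runit E : exists h : coext_hom (baer E (semidirect A)) E,
  forall n, h (bp n (sd_zero A (proj E n))) = n.
Proof.
have [h hE] := baer_lunit E; exists (coext_comp h (baer_swap E (semidirect A))).
by move=> n /=; rewrite baer_swap_bp // hE.
Qed.

(** A symbol (a, x) * n equals (a, 0) * (x n). *)
Lemma bp_lunit_surj E (c : carrier (baer (semidirect A) E)) :
  exists n, c = bp (sd_zero A (proj E n)) n.
Proof.
have [[a x] [n [/= an ->]]] := bp_surj c; subst a.
by exists (act x n); rewrite proj_act bp_actr // -bp_actl // sd_act_zero.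
Qed.

Lemma bp_runit_surj E (c : carrier (baer E (semidirect A))) :
  exists n, c = bp n (sd_zero A (proj E n)).
Proof.
have [n [[a x] [/= an ->]]] := bp_surj c; subst a.
by exists (act x n); rewrite proj_act bp_actl // -bp_actr // sd_act_zero.
Qed.

(** With j n = [0, n] one has j (x n) = (- x) (j n), hence
    (x n) * j (x n) = (x - x) (n * j n) = n * j n. So n * j n depends only on
    the point below n, and is multiplicative in it. *)
Lemma baer_coext_inv E :
  inhabited (coext_hom (semidirect A) (baer E (coext_inv E))).
Proof.
pose j := pf_of (neg A) (E := E); pose d n := bp n (j n).
have jP n : proj E n = proj (coext_inv E) (j n) by rewrite proj_pf_of.
have dE n n' : proj E n = proj E n' -> d n = d n'.
  move=> /act_trans[x ->]; rewrite /d {2}/j pf_of_act bp_act //.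
  by rewrite addrN act0.
have [s sP] := choice (proj_surj E).
apply: (@hom_of_section _ _ _ (fun a => d (s a))) => [a||a b].
- by rewrite proj_bp.
- by rewrite -(bp1 E (coext_inv E)) (dE _ 1) // sP gmulf1.
rewrite bpM // -pf_ofM; apply: dE.
by rewrite gmulfM !sP.
Qed.

Lemma baer_hom_ext E F G (h k : coext_hom (baer E F) G) :
  (forall n n', proj E n = proj F n' -> h (bp n n') = k (bp n n')) -> h = k.
Proof.
move=> hk; apply: coext_hom_eq => c.
by have [n [n' [e ->]]] := bp_surj c; exact: hk.
Qed.

Lemma baer_hom_ext3 E F G H (h k : coext_hom (baer (baer E F) G) H) :
  (forall e f g, proj E e = proj F f -> proj F f = proj G g ->
    h (bp (bp e f) g) = k (bp (bp e f) g)) -> h = k.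
Proof.
move=> hk; apply: baer_hom_ext => c g.
have [e [f [ef ->]]] := bp_surj c; rewrite proj_bp // ef; exact: hk.
Qed.

Lemma baer_symmetric_monoidal : inhabited
  (@symmetric_monoidal (Coext_category A) (@baer M A) (@baer_hom M A)
    (semidirect A) (@baer_swap M A)).
Proof.
pose as_ E F G := sval (cid (baer_assoc E F G)).
have asE E F G (e : carrier E) (f : carrier F) (g : carrier G) :
  proj E e = proj F f -> proj F f = proj G g ->
  as_ E F G (bp (bp e f) g) = bp e (bp f g)
  by exact: (svalP (cid (baer_assoc E F G))).
pose lu E := sval (cid (baer_lunit E)).
have luE E (n : carrier E) : lu E (bp (sd_zero A (proj E n)) n) = n
  by exact: (svalP (cid (baer_lunit E))).
pose ru E := sval (cid (baer_runit E)).
have ruE E (n : carrier E) : ru E (bp n (sd_zero A (proj E n))) = n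
  by exact: (svalP (cid (baer_runit E))).
constructor.
apply: (@SymmetricMonoidal (Coext_category A) _ _ _ _ _ _ as_ _ _ lu _ _ ru).
- by move=> E F; apply: baer_hom_ext => e f ef; rewrite baer_homE.
- move=> E F G E' F' G' g f g' f'; apply: baer_hom_ext => e e' ee' /=.
  by rewrite !baer_homE ?hmap_proj.
- by move=> E F G; exact: coext_hom_is_iso.
- move=> E F G E' F' G' f g h; apply: baer_hom_ext3 => a b c ab bc /=.
  by do !rewrite (baer_homE, asE) ?proj_bp ?hmap_proj ?ab.
- by move=> E; exact: coext_hom_is_iso.
- move=> E F f; apply: coext_hom_eq => c.
  have [n ->] := bp_lunit_surj c.
  by rewrite /= baer_homE //= luE -(hmap_proj f n) luE.
- by move=> E; exact: coext_hom_is_iso.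
- move=> E F f; apply: coext_hom_eq => c.
  have [n ->] := bp_runit_surj c.
  by rewrite /= baer_homE //= ruE -(hmap_proj f n) ruE.
- move=> E F E' F' f g; apply: baer_hom_ext => a b ab /=.
  by rewrite baer_homE // !baer_swap_bp ?hmap_proj // baer_homE.
- move=> E F; apply: baer_hom_ext => a b ab /=.
  by rewrite !baer_swap_bp.
- move=> E F G H; apply: baer_hom_ext3 => x c d.
  have [a [b [ab ->]]] := bp_surj x; rewrite proj_bp // => ac cd /=.
  by do !rewrite (baer_homE, asE) ?proj_bp ?ab -?ab ?ac -?cd -?ac //=.
- move=> E F; apply: baer_hom_ext => c b.
  have [n ->] := bp_runit_surj c; rewrite proj_bp // => nb /=.
  by rewrite asE // !baer_homE ?proj_bp //= ruE nb luE.
move=> E F G; apply: baer_hom_ext3 => a b c ab bc /=.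
by do !rewrite (baer_homE, asE, baer_swap_bp) ?proj_bp ?ab //.
Qed.

End MonoidalStructure.

(** * Isomorphism classes and automorphisms of the unit *)

Section SymmetricCategoricalGroup.
Variables (C : category) (tens : C -> C -> C).
Variable tensm : forall a b a' b' : C,
  Defs.Hom a b -> Defs.Hom a' b' -> Defs.Hom (tens a a') (tens b b').
Variables (unit : C) (sym : forall a b : C, Defs.Hom (tens a b) (tens b a)).
Variable S : symmetric_monoidal tensm unit sym.

Lemma isomorphic_refl (a : C) : isomorphic a a.
Proof. by exists (idc a), (idc a); rewrite compc1f. Qed.

Lemma isomorphic_sym (a b : C) : isomorphic a b -> isomorphic b a.
Proof. by move=> [f [g [gf fg]]]; exists g, f. Qed.

Lemma isomorphic_trans (a b c : C) :
  isomorphic a b -> isomorphic b c -> isomorphic a c.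
Proof.
move=> [f [f' [f'f ff']]] [g [g' [g'g gg']]].
exists (compc g f), (compc f' g'); split.
  by rewrite -compcA [X in compc _ X]compcA g'g compc1f.
by rewrite -compcA [X in compc _ X]compcA ff' compc1f.
Qed.

Lemma isomorphic_tens (a b a' b' : C) :
  isomorphic a b -> isomorphic a' b' -> isomorphic (tens a a') (tens b b').
Proof.
move=> [f [f' [f'f ff']]] [g [g' [g'g gg']]].
exists (tensm f g), (tensm f' g'); split; rewrite -(tensm_comp S).
  by rewrite f'f g'g (tensm_id S).
by rewrite ff' gg' (tensm_id S).
Qed.

Lemma pi0_classP (a b : C) : pi0_class a = pi0_class b <-> isomorphic a b.
Proof.
split=> [/(congr1 sval) /= -> | ab]; first exact: isomorphic_refl.
apply: eq_exist => /=; apply: funext => c; apply: propext.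
split; apply: isomorphic_trans => //; exact: isomorphic_sym.
Qed.

Lemma pi0_surj (P : pi0 C) : exists a, P = pi0_class a.
Proof. by case: P => P [a aP]; exists a; exact: eq_exist. Qed.

(** The tensor product descends to classes because it preserves isomorphisms;
    it is computed on chosen representatives. *)
Lemma pi0_abelian_group (inv : C -> C) :
  (forall a, isomorphic (tens (inv a) a) unit) ->
  exists add : pi0 C -> pi0 C -> pi0 C,
    (forall a b, add (pi0_class a) (pi0_class b) = pi0_class (tens a b)) /\
    is_abelian_group add (pi0_class unit).
Proof.
move=> invP; have [r rP] := choice pi0_surj.
exists (fun P Q => pi0_class (tens (r P) (r Q))).
have addE a b :
    pi0_class (tens (r (pi0_class a)) (r (pi0_class b))) = pi0_class (tens a b).
  by apply/pi0_classP/isomorphic_tens; apply/pi0_classP; rewrite -rP.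
split=> //; split.
- move=> P Q T; have [a ->] := pi0_surj P; have [b ->] := pi0_surj Q.
  have [c ->] := pi0_surj T; rewrite (addE b c) (addE a b) !addE.
  by apply/esym/pi0_classP; exists (assoc S a b c); exact: assoc_iso.
- move=> P Q; apply/pi0_classP; exists (sym _ _), (sym _ _).
  by split; exact: (symK S).
- move=> P; have [a ->] := pi0_surj P; rewrite addE; apply/pi0_classP.
  by exists (lunit S a); exact: lunit_iso.
- move=> P; have [a ->] := pi0_surj P; exists (pi0_class (inv a)).
  by rewrite addE; exact/pi0_classP.
Qed.

(** Endomorphisms h (x) 1 and 1 (x) g of unit (x) unit commute by functoriality.
    The unitors identify both families with the endomorphisms of the unit, so
    each 1 (x) f is also some h (x) 1, and f |-> 1 (x) f is injective. *)
Lemma unit_endo_comm (f g : Defs.Hom unit unit) : compc f g = compc g f.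
Proof.
have [l' [l'l ll']] := lunit_iso S unit.
have [r' [r'r _]] := runit_iso S unit.
have inj (h k : Defs.Hom unit unit) :
    tensm (idc unit) h = tensm (idc unit) k -> h = k.
  move=> hk; rewrite -[h]compcf1 -[k]compcf1 -ll' !compcA.
  by rewrite -!(lunit_nat S) hk.
have [h hE] : exists h : Defs.Hom unit unit,
    tensm h (idc unit) = tensm (idc unit) f.
  have -> : tensm (idc unit) f = compc l' (compc f (lunit S unit)).
    by rewrite -(lunit_nat S) compcA l'l compc1f.
  (* h = r (1 (x) f) r^-1, so that h (x) 1 = r^-1 h r = 1 (x) f. *)
  exists (compc (runit S unit) (compc (compc l' (compc f (lunit S unit))) r')).
  set h := compc (runit S unit) _.
  rewrite -[LHS]compc1f -r'r -compcA (runit_nat S) /h -!compcA r'r compcf1.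
  by rewrite compcA r'r compc1f.
(* In each composite the identity on the left factor is split in two. *)
by apply: inj; rewrite -[idc unit](compc1f (idc unit)) !(tensm_comp S) -hE
  -!(tensm_comp S) !(compc1f, compcf1).
Qed.

Lemma aut_unit_abelian_group :
  is_abelian_group (@aut_comp C unit) (aut_one unit).
Proof.
split=> [f g h|f g|f|[f [f' [f'f ff']]]].
- by apply: eq_exist; exact: compcA.
- by apply: eq_exist; exact: unit_endo_comm.
- by case: f => f fP; apply: eq_exist; exact: compc1f.
by exists (exist _ f' (ex_intro _ f (conj ff' f'f))); exact: eq_exist.
Qed.

End SymmetricCategoricalGroup.

Theorem proposition3p20 (M : comMonoidType) (A : system M) :
  [/\ @is_symmetric_categorical_group (Coext_category A) (@baer M A)
        (@baer_hom M A) (semidirect A) (@coext_inv M A) (@baer_swap M A),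
      exists add : pi0 (Coext_category A) -> pi0 (Coext_category A) ->
                   pi0 (Coext_category A),
        (forall E F : Coext_category A,
           add (pi0_class E) (pi0_class F) =
           pi0_class (baer E F : Coext_category A)) /\
        is_abelian_group add (pi0_class (semidirect A : Coext_category A)) &
      is_abelian_group (@aut_comp (Coext_category A) (semidirect A))
        (aut_one (semidirect A : Coext_category A))].
Proof.
have [S] := baer_symmetric_monoidal A.
have homI (E F : Coext_category A) (f : coext_hom E F) : isomorphic E F.
  by exists f; exact: coext_hom_is_iso.
have invR (E : Coext_category A) :
    isomorphic (baer E (coext_inv E) : Coext_category A) (semidirect A).
  by have [h] := baer_coext_inv E; exact: isomorphic_sym (homI _ _ h).
have invL (E : Coext_category A) :
    isomorphic (baer (coext_inv E) E : Coext_category A) (semidirect A).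
  exact: isomorphic_trans (homI _ _ (baer_swap _ _)) (invR E).
split.
- split; first by move=> E F f; exact: coext_hom_is_iso.
    by exists.
  by move=> E; split.
- exact: (pi0_abelian_group S invL).
exact: (aut_unit_abelian_group S).
Qed.
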